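(* Fix an integer $k\ge1$. Let $\Omega\subset D=[0,1]^2$ be a domain of class $\mathcal C^s$ for some $s>1$ and let $u=\chi_\Omega$. Then there exists $h^*=h^*(\Omega)>0$ such that, whenever the mesh size satisfies $h<h^*$, the following holds for every singular cell $T\in\mathcal S_h$. Let $(H_T,V_T)$ be the Sobel numerical gradient computed from the cell averages of $u$ on the $3\times3$ stencil centered at $T$, and consider the four cases of the selection mechanism: 1. $|V_T|\ge|H_T|$ and $V_T\le0$: form $y\le p(x)$; 2. $|V_T|\ge|H_T|$ and $V_T>0$: form $y\ge p(x)$; 3. $|V_T|<|H_T|$ and $H_T\le0$: form $x\le p(y)$; 4. $|V_T|<|H_T|$ and $H_T>0$: form $x\ge p(y)$. In each of these cases, the exact domain $\Omega$ can be described by an equation of the same form with $p$ replaced by a function $\psi\in\mathcal C^s$ over the stencil $S_T$ centered at $T$ and of size $(2k+1)\times(2l+1)$ in cases 1, 2, or $(2l+1)\times(2k+1)$ in cases 3, 4, with $l=k+2$. Moreover, the graph of $\psi$ remains confined in $S_T$ in the following sense: denoting by $I\times J:=\bigcup\{\tilde T:\tilde T\in S_T\}$ the total support of $S_T$, one has $\psi(I)\subset J$ in cases 1, 2 and $\psi(J)\subset I$ in cases 3, 4.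
   Context: **Mesh.** For $h=1/N_0$ with an integer $N_0>1$, $\mathcal T_h$ is the set of the cells $T=h(\kappa+[0,1]^2)$, $\kappa\in\{0,\dots,N_0-1\}^2$, partitioning $D$. $a_T(u)=\frac1{|T|}\int_Tu$. A cell $T$ is singular if $|T\cap\Omega|\ne0$ and $|T\cap\Omega^c|\ne0$; $\mathcal S_h$ is the set of singular cells. Near $\partial D$, stencils are taken in the extended grid of cells $h(\kappa+[0,1]^2)$, $\kappa\in\mathbb Z^2$, with $u=\chi_\Omega$ viewed as a function on $\mathbb R^2$. A stencil of size $a\times b$ has $a$ cells in the $x$ direction and $b$ cells in the $y$ direction. **Sobel gradient.** For $(\varepsilon_x,\varepsilon_y)\in\{-1,0,1\}^2$, $T_{\varepsilon_x,\varepsilon_y}$ is the cell obtained by translating $T$ by $(\varepsilon_xh,\varepsilon_yh)$. With $a_{T_{\varepsilon}}=a_{T_\varepsilon}(u)$, $$H_T:=2a_{T_{1,0}}+a_{T_{1,1}}+a_{T_{1,-1}}-(2a_{T_{-1,0}}+a_{T_{-1,1}}+a_{T_{-1,-1}}),$$ $$V_T:=2a_{T_{0,1}}+a_{T_{1,1}}+a_{T_{-1,1}}-(2a_{T_{0,-1}}+a_{T_{1,-1}}+a_{T_{-1,-1}}).$$ **''Described over $S_T$''.** For instance in case 1: for all $(x,y)\in I\times J$, $(x,y)\in\Omega\iff y\le\psi(x)$, with $\psi\in\mathcal C^s(I)$; in cases 3, 4, $\psi\in\mathcal C^s(J)$. **$\mathcal C^s$ domains.** A domain $\Omega\subset\mathbb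 R^2$ is of class $\mathcal C^s$ if there exist $R>0$, $P>1$, $M>0$ such that for every $z_0\in\partial\Omega$ there exist an orthonormal system $(e_1,e_2)$ and $\psi\in\mathcal C^s([-R,R])$ with $\|\psi\|_{\mathcal C^s}\le M$, with values in $[-PR,PR]$, such that $z\in\Omega\iff z_2\le\psi(z_1)$ for any $z=z_0+z_1e_1+z_2e_2$ with $|z_1|\le R$, $|z_2|\le PR$. Here $\mathcal C^s$ for non-integer $s$ is the usual Hölder space, with norm $$\|\psi\|_{\mathcal C^s}=\sup_{0\le j\le\lfloor s\rfloor}\|\psi^{(j)}\|_{L^\infty}+\sup_{x\ne t}|x-t|^{\lfloor s\rfloor-s}|\psi^{(\lfloor s\rfloor)}(x)-\psi^{(\lfloor s\rfloor)}(t)|,$$ and for integer $s$ it denotes the functions with Lipschitz derivatives up to order $s-1$, with the corresponding norm. (For $s>1$ the paper uses the equivalent definition in which, near each boundary point $z_0=(x_0,y_0)$, membership in $\Omega$ is given by one of $y\le\psi(x)$, $y\ge\psi(x)$ for $|x-x_0|\le R,\ |y-y_0|\le PR$, or one of $x\le\psi(y)$, $x\ge\psi(y)$ for $|y-y_0|\le R,\ |x-x_0|\le PR$.) *)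

(* Defs.v *)
From HB Require Import structures.
From mathcomp Require Import all_boot all_order all_algebra.
From mathcomp Require Import zify.
From mathcomp Require Import all_classical all_reals all_analysis.
Set Implicit Arguments.
Unset Strict Implicit.
Unset Printing Implicit Defensive.
Import Order.TTheory GRing.Theory Num.Theory.
Import numFieldNormedType.Exports.
Local Open Scope classical_set_scope.
Local Open Scope ring_scope.

(* For non-integer s this is the floor of s; for an integer s, where C^s stands
   for Lipschitz derivatives up to order s - 1, it is s - 1. In both cases the
   Hölder exponent s - holder_order s lies in ]0, 1] when s > 0. *)
Definition holder_order (R : realType) (s : R) : nat :=
  if s \is a Num.int then (Num.truncn s).-1 else Num.truncn s.

(* Derivatives are taken in the open interval ]a, b[, where the two-sided
   derivative makes sense. All of them up to the top order are uniformly
   continuous there as soon as holder_norm is finite, so that they extend to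
   `[a, b] and the suprema over ]a, b[ and over [a, b] coincide. *)
Definition holder_norm (R : realType) (s a b : R) (psi : R -> R) : \bar R :=
  (ereal_sup [set r | exists2 j, (j <= holder_order s)%N &
      exists2 x, x \in `]a, b[ & r = `|derive1n j psi x|%:E]
   + ereal_sup [set r | exists x t, [/\ x \in `]a, b[, t \in `]a, b[, x != t &
      r = (`|x - t| `^ ((holder_order s)%:R - s)
           * `|derive1n (holder_order s) psi x - derive1n (holder_order s) psi t|)%:E]])%E.

(* psi \in C^s([a, b]); only the values of psi on [a, b] matter. *)
Definition holder_class (R : realType) (s a b : R) (psi : R -> R) : Prop :=
  [/\ {within `[a, b], continuous psi},
      forall (j : nat) (x : R), (j < holder_order s)%N -> x \in `]a, b[ ->
        derivable (derive1n j psi) x 1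
    & (holder_norm s a b psi < +oo)%E].

Definition boundary (T : topologicalType) (A : set T) : set T :=
  closure A `\` interior A.

Definition dot2 (R : realType) (v w : R * R) : R := v.1 * w.1 + v.2 * w.2.

Definition orthonormal2 (R : realType) (e1 e2 : R * R) : Prop :=
  [/\ dot2 e1 e1 = 1, dot2 e2 e2 = 1 & dot2 e1 e2 = 0].

Definition Cs_domain (R : realType) (s : R) (Omega : set (R * R)) : Prop :=
  exists r P M : R, [/\ 0 < r, 1 < P, 0 < M &
    forall z0 : R * R, boundary Omega z0 ->
    exists (e1 e2 : R * R) (psi : R -> R),
    [/\ orthonormal2 e1 e2,
        holder_class s (- r) r psi /\ (holder_norm s (- r) r psi <= M%:E)%E,
        forall t, `|t| <= r -> `|psi t| <= P * r
      & forall z1 z2, `|z1| <= r -> `|z2| <= P * r ->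
          (Omega (z0 + z1 *: e1 + z2 *: e2) <-> z2 <= psi z1)]].

Definition lebesgue2 (R : realType) :
    {measure set (measurableTypeR R * measurableTypeR R) -> \bar R} :=
  (@lebesgue_measure R \x @lebesgue_measure R)%E.

Definition unit_square (R : realType) : set (R * R) := `[0, 1] `*` `[0, 1].
Arguments unit_square : clear implicits.

Definition cell (R : realType) (h : R) (kappa : int * int) : set (R * R) :=
  `[h * kappa.1%:~R, h * (kappa.1 + 1)%:~R]
  `*` `[h * kappa.2%:~R, h * (kappa.2 + 1)%:~R].

Definition cell_average (R : realType) (u : R * R -> R) (T : set (R * R)) : R :=
  (fine (lebesgue2 R T))^-1 * \int[lebesgue2 R]_(z in T) u z.

Definition singular_cell (R : realType) (Omega T : set (R * R)) : Prop :=
  lebesgue2 R (T `&` Omega) != 0%E /\ lebesgue2 R (T `&` ~` Omega) != 0%E.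

Definition stencil (R : realType) (h : R) (kappa : int * int) (k l : nat) :
    set (set (R * R)) :=
  [set T | exists2 eps : int * int, `|eps.1| <= k%:Z /\ `|eps.2| <= l%:Z
    & T = cell h (kappa.1 + eps.1, kappa.2 + eps.2)].

Definition stencil_lo (R : realType) (h : R) (i : int) (k : nat) : R :=
  h * (i - k%:Z)%:~R.

Definition stencil_hi (R : realType) (h : R) (i : int) (k : nat) : R :=
  h * (i + k%:Z + 1)%:~R.

(* The two factors of the total support of a stencil: see stencil_supportE. *)
Definition stencil_side (R : realType) (h : R) (i : int) (k : nat) : interval R :=
  `[stencil_lo h i k, stencil_hi h i k].

Lemma stencil_side1P (R : realType) (h : R) (h0 : 0 < h) (i : int) (k : nat) x :
  x \in stencil_side h i k <-> exists2 e : int, `|e| <= k%:Z &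
    x \in `[h * (i + e)%:~R, h * (i + e + 1)%:~R].
Proof.
rewrite in_itv /= /stencil_lo /stencil_hi; split.
  move=> /andP[lo hi].
  pose f := Num.floor (x / h).
  have /andP[f1 f2] : f%:~R <= x / h < (f + 1)%:~R by apply/andP; split;
    [exact: Num.Theory.floor_le | exact: floorD1_gt].
  have lof : i - k%:Z <= f by rewrite floor_ge_int ler_pdivlMr // mulrC.
  have [fk|kf] := leP f (i + k%:Z).
    exists (f - i); first by rewrite ler_norml; lia.
    rewrite in_itv /= [i + _]addrC subrK; apply/andP; split.
      by rewrite mulrC -ler_pdivlMr.
    by rewrite mulrC -ler_pdivrMr // ltW.
  exists k%:Z; first by rewrite ger0_norm.
  rewrite in_itv /= hi andbT mulrC -ler_pdivlMr //.
  by apply: le_trans f1; rewrite ler_int ltW.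
move=> [e]; rewrite ler_norml => /andP[e1 e2]; rewrite in_itv /= => /andP[lo hi].
apply/andP; split.
  by apply: le_trans lo; rewrite ler_pM2l // ler_int; lia.
by apply: (le_trans hi); rewrite ler_pM2l // ler_int; lia.
Qed.

Lemma stencil_supportE (R : realType) (h : R) (h0 : 0 < h) (kappa : int * int)
    (k l : nat) :
  \bigcup_(T in stencil h kappa k l) T =
  [set` stencil_side h kappa.1 k] `*` [set` stencil_side h kappa.2 l].
Proof.
apply/seteqP; split => -[x y] /=.
  move=> [T [[e1 e2] [/= he1 he2] ->] [/= xT yT]]; split => /=.
    by apply/(stencil_side1P h0); exists e1.
  by apply/(stencil_side1P h0); exists e2.
move=> [/= /(stencil_side1P h0)[e1 he1 xT] /(stencil_side1P h0)[e2 he2 yT]].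
exists (cell h (kappa.1 + e1, kappa.2 + e2)); last by split.
by exists (e1, e2).
Qed.

(* T_eps, the translate of a cell T by h * eps, is the cell of shifted index. *)
Definition sobel_H (R : realType) (u : R * R -> R) (h : R) (kappa : int * int) : R :=
  let a (ex ey : int) := cell_average u (cell h (kappa.1 + ex, kappa.2 + ey)) in
  2 * a 1 0 + a 1 1 + a 1 (-1) - (2 * a (-1) 0 + a (-1) 1 + a (-1) (-1)).

Definition sobel_V (R : realType) (u : R * R -> R) (h : R) (kappa : int * int) : R :=
  let a (ex ey : int) := cell_average u (cell h (kappa.1 + ex, kappa.2 + ey)) in
  2 * a 0 1 + a 1 1 + a (-1) 1 - (2 * a 0 (-1) + a 1 (-1) + a (-1) (-1)).

(* Main.v *)
Require Import Defs.
From HB Require Import structures.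
From mathcomp Require Import all_boot all_order all_algebra.
From mathcomp Require Import ring lra zify.
From mathcomp Require Import all_classical all_reals all_analysis.
From mathcomp Require Import measurable_realfun.
Import Order.TTheory GRing.Theory Num.Theory.
Import numFieldNormedType.Exports.
Local Open Scope classical_set_scope.
Local Open Scope ring_scope.
Set Implicit Arguments.
Unset Strict Implicit.
Unset Printing Implicit Defensive.

(** Near a boundary point, the domain is [G <= 0] for the function
    [G = z2 - psi z1] of the coordinates [(z1, z2)] in an orthonormal frame
    [(e1, e2)]. Since [s > 1], the derivative of [psi] has a modulus of continuity
    that is uniform over the boundary; hence, at a small enough scale, it stays
    within a prescribed [eta] of a constant [p], and the increments of [G] are
    those of the linear form given by the normal [nu = e2 - p e1], up to an error
    [eta (|dx| + |dy|)] ([level_near_linear]). The rest is read off this estimate,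
    around a boundary point [z0] of the singular cell.

    Direction of the normal. Areas are compared, not computed. If [G] decreases
    along an integer vector [v], then the translation by [h v] maps the part of
    the domain in a cell [T] into the domain, so the average over [T] is at most
    the average over [T + h v]. Both components of the Sobel gradient, as well as
    the combinations [H + V], [H - V] and their opposites, are sums with positive
    weights of such differences of averages. One of the differences is taken over
    cells that are opposite with respect to the center, and is strict: [z0] is
    translated into these two cells, on either side of the interface
    ([average_lt]). Therefore [|nu1| > |nu2| + 2 eta] implies [|H| > |V|], and [V]
    has the sign opposite to that of [nu2] when [|nu2| > eta]; likewise with the
    axes exchanged ([chart_sobel]). As [|nu1| + |nu2| >= 1], in the first two
    cases [nu2] is bounded away from 0 and [V] determines its sign.

    Graph. In these cases [G] is strictly monotone in [y], so its zero set is a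
    graph over the [x] axis, which stays in the cone of slope [1 + 1 / (k + 1)]
    with apex [z0]. Over a stencil of half-width [k] it leaves the row of [z0] by
    at most [k + 2] cells ([stencil_graph]). For its regularity, the curve is
    parametrized by [z1]: the abscissa [X] has a Lipschitz inverse [tau], which
    solves [tau' = 1 / X' (tau)], and a bootstrap in this equation gives [tau],
    then the graph, as many Hölder derivatives as [psi] has ([hol_ode],
    [level_zero_graph]). *)

(** * Hölder functions on an open interval *)

Section HolderFunctions.
Context {R : realType}.
Implicit Types (al a b c d : R) (f g tau : R -> R) (n : nat).

(** The derivatives are witnesses that matter on ]a, b[ only: unlike iterated
    total derivatives, they can be given in closed form, which is what makes
    the stability lemmas below plain inductions on [n]. *)
Fixpoint hol al a b n f : Prop :=
  (exists C : R, forall x, x \in `]a, b[ -> `|f x| <= C) /\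
  if n is n'.+1 then
    exists2 g : R -> R, (forall x, x \in `]a, b[ -> is_derive x 1 f (g x)) &
      hol al a b n' g
  else exists C : R, forall x t, x \in `]a, b[ -> t \in `]a, b[ ->
    `|f x - f t| <= C * `|x - t| `^ al.

Lemma hol_deriv al a b n f : hol al a b n.+1 f ->
  exists2 g, (forall x, x \in `]a, b[ -> is_derive x 1 f (g x)) &
    hol al a b n g.
Proof. by case. Qed.

Lemma hol_bounded al a b n f : hol al a b n f ->
  exists2 C, 0 <= C & forall x, x \in `]a, b[ -> `|f x| <= C.
Proof.
case: n => [|n] [[C fC] _]; exists (Num.max 0 C); rewrite ?le_max ?lexx //;
  by move=> x /fC h; rewrite le_max h orbT.
Qed.

Lemma hol0_modulus al a b f : hol al a b 0 f ->
  exists2 C, 0 <= C & forall x t, x \in `]a, b[ -> t \in `]a, b[ ->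
    `|f x - f t| <= C * `|x - t| `^ al.
Proof.
move=> [_ [C fC]]; exists (Num.max 0 C); first by rewrite le_max lexx.
move=> x t xab tab; apply: (le_trans (fC _ _ xab tab)).
by rewrite ler_wpM2r ?powR_ge0 // le_max lexx orbT.
Qed.

Lemma hol_subset al a b c d n f : `]c, d[ `<=` `]a, b[ ->
  hol al a b n f -> hol al c d n f.
Proof.
move=> sub; elim: n f => [|n IH] f [[C fC] h]; split.
- by exists C => x /sub /fC.
- by case: h => K fK; exists K => x t /sub xab /sub tab; exact: fK.
- by exists C => x /sub /fC.
- by case: h => g fg /IH hg; exists g => // x /sub /fg.
Qed.

(** The mean value theorem for [f - p id]: a derivative that stays close to
    [p] on an interval makes all increments close to those of slope [p]. *)
Lemma derive_near_affine a b f g (p C : R) :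
  (forall x, x \in `]a, b[ -> is_derive x 1 f (g x)) ->
  (forall x, x \in `]a, b[ -> `|g x - p| <= C) ->
  forall x t, x \in `]a, b[ -> t \in `]a, b[ ->
    `|f x - f t - p * (x - t)| <= C * `|x - t|.
Proof.
move=> fg gC.
suff main x t : t < x -> x \in `]a, b[ -> t \in `]a, b[ ->
    `|f x - f t - p * (x - t)| <= C * `|x - t|.
  move=> x t xab tab; have [xt|tx|->] := ltgtP x t; last 2 first.
  - exact: main.
  - by rewrite !subrr mulr0 subrr normr0 mulr0.
  - have := main _ _ xt tab xab; rewrite distrC [`|x - t|]distrC.
    by congr (_ <= _); congr (`|_|); ring.
move=> tx xab tab.
have sub y : y \in `[t, x] -> y \in `]a, b[.
  move: xab tab; rewrite !in_itv /= => /andP[_ xb] /andP[at_ _] /andP[ty yx].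
  by rewrite (lt_le_trans at_ ty) (le_lt_trans yx xb).
have dfx y : y \in `]t, x[ -> is_derive y 1 f (g y).
  by move=> ytx; apply: fg; apply: sub; apply: subset_itv_oo_cc.
have cf : {within `[t, x], continuous f}.
  by apply: derivable_within_continuous => y /sub /fg dy; exact: ex_derive.
have [y ytx ->] := MVT tx dfx cf.
rewrite -mulrBl normrM ler_wpM2r //; apply: gC; apply: sub.
exact: subset_itv_oo_cc.
Qed.

Variable al : R.
Hypotheses (al0 : 0 < al) (al1 : al <= 1).

(** On a bounded interval a Lipschitz function is [al]-Hölder. *)
Lemma lipschitz_modulus a b x t : x \in `]a, b[ -> t \in `]a, b[ ->
  `|x - t| <= (b - a) `^ (1 - al) * `|x - t| `^ al.
Proof.
move=> xab tab; have [->|xt] := eqVneq x t.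
  by rewrite subrr normr0 mulr_ge0 // powR_ge0.
have d0 : 0 < `|x - t| by rewrite normr_gt0 subr_eq0.
have dab : `|x - t| <= b - a.
  by move: xab tab; rewrite !in_itv /= => /andP[? ?] /andP[? ?]; rewrite ler_norml; lra.
rewrite -[leLHS]powRr1 //.
have ba : 0 <= b - a by exact: le_trans (ltW d0) dab.
have -> : 1 = (1 - al) + al :> R by ring.
rewrite powRD; last by apply/implyP => _; exact: lt0r_neq0.
rewrite addrK ler_wpM2r ?powR_ge0 // ge0_ler_powR ?nnegrE // subr_ge0 //.
Qed.

Lemma derive_bounded_modulus a b f g :
  (forall x, x \in `]a, b[ -> is_derive x 1 f (g x)) ->
  (exists C : R, forall x, x \in `]a, b[ -> `|g x| <= C) ->
  exists C, forall x t, x \in `]a, b[ -> t \in `]a, b[ ->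
    `|f x - f t| <= C * `|x - t| `^ al.
Proof.
move=> fg [C gC]; exists (Num.max 0 C * (b - a) `^ (1 - al)) => x t xab tab.
have gC' y : y \in `]a, b[ -> `|g y - 0| <= C by rewrite subr0; exact: gC.
have := derive_near_affine fg gC' xab tab; rewrite mul0r subr0.
move=> /le_trans; apply; rewrite -mulrA; apply: ler_pM => //.
- exact: le_trans (normr_ge0 _) (gC _ xab).
- by rewrite le_max lexx orbT.
- exact: lipschitz_modulus.
Qed.

Lemma hol_pred a b n f : hol al a b n.+1 f -> hol al a b n f.
Proof.
elim: n f => [|n IH] f [fb [g fg hg]]; split => //.
- apply: (derive_bounded_modulus fg).
  by have [C _ gC] := @hol_bounded al a b 0 g hg; exists C.
- by exists g => //; apply: IH.
Qed.

Lemma hol_le a b m n f : (m <= n)%N -> hol al a b n f -> hol al a b m f.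
Proof.
move=> /subnKC <-; elim: (n - m)%N f => [|k IH] f; first by rewrite addn0.
by rewrite addnS => /hol_pred /IH.
Qed.

Lemma hol_cst a b n (k : R) : hol al a b n (fun=> k).
Proof.
elim: n k => [|n IH] k; split; try by exists `|k|.
  by exists 0 => x t _ _; rewrite subrr normr0 mul0r.
by exists (fun=> 0) => // x _; exact: is_derive_cst.
Qed.

Lemma hol_id a b n : hol al a b n id.
Proof.
have bd : exists C : R, forall x, x \in `]a, b[ -> `|x| <= C.
  exists (`|a| + `|b|) => x; rewrite in_itv /= => /andP[ax xb].
  have := ler_norm b; have := ler_norm (- a); rewrite normrN => ? ?.
  have := normr_ge0 b; have := normr_ge0 a => ? ?.
  by rewrite ler_norml; lra.
case: n => [|n]; split => //.
  exists ((b - a) `^ (1 - al)) => x t; exact: lipschitz_modulus.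
by exists (fun=> 1); [move=> x _; exact: is_derive_id|exact: hol_cst].
Qed.

Lemma hol_add a b n f g : hol al a b n f -> hol al a b n g ->
  hol al a b n (fun x => f x + g x).
Proof.
elim: n f g => [|n IH] f g hf hg; have [[C fC] hf0] := hf;
  have [[K gK] hg0] := hg; split;
  try (exists (C + K) => x xab; apply: (le_trans (ler_normD _ _));
       by apply: lerD; [exact: fC|exact: gK]).
- have [C' fC'] := hf0; have [K' gK'] := hg0; exists (C' + K') => x t xab tab.
  rewrite opprD addrACA mulrDl; apply: (le_trans (ler_normD _ _)).
  by apply: lerD; [exact: fC'|exact: gK'].
- have [f' ff' hf'] := hol_deriv hf; have [g' gg' hg'] := hol_deriv hg.
  exists (fun x => f' x + g' x); last exact: IH.
  by move=> x xab; apply: is_deriveD; [exact: ff'|exact: gg'].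
Qed.

Lemma hol_mul a b n f g : hol al a b n f -> hol al a b n g ->
  hol al a b n (fun x => f x * g x).
Proof.
elim: n f g => [|n IH] f g hf hg; have [C C0 fC] := hol_bounded hf;
  have [K K0 gK] := hol_bounded hg; split;
  try by (exists (C * K) => x xab; rewrite normrM ler_pM ?fC ?gK).
- have [C' C'0 fC'] := hol0_modulus hf; have [K' K'0 gK'] := hol0_modulus hg.
  exists (C * K' + C' * K) => x t xab tab.
  have -> : f x * g x - f t * g t = f x * (g x - g t) + (f x - f t) * g t.
    by ring.
  apply: (le_trans (ler_normD _ _)); rewrite !normrM mulrDl; apply: lerD.
    by rewrite -mulrA ler_pM // ?fC ?gK'.
  by rewrite mulrAC ler_pM // ?fC' ?gK.
- have [f' ff' hf'] := hol_deriv hf; have [g' gg' hg'] := hol_deriv hg.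
  exists (fun x => f x * g' x + g x * f' x).
    by move=> x xab; apply: is_deriveM; [exact: ff'|exact: gg'].
  by apply: hol_add; apply: IH => //; exact: hol_pred.
Qed.

Lemma hol_inv a b n f c : 0 < c -> (forall x, x \in `]a, b[ -> c <= `|f x|) ->
  hol al a b n f -> hol al a b n (fun x => (f x)^-1).
Proof.
move=> c0 fc.
have f0 x : x \in `]a, b[ -> f x != 0.
  by move=> /fc; rewrite -normr_gt0; exact: lt_le_trans.
have iC x : x \in `]a, b[ -> `|(f x)^-1| <= c^-1.
  by move=> xab; rewrite normfV lef_pV2 ?posrE ?fc // normr_gt0 f0.
elim: n => [|n IH] hf; split; try by exists c^-1.
- have [C C0 fC] := hol0_modulus hf.
  exists (c^-1 * c^-1 * C) => x t xab tab.
  have -> : (f x)^-1 - (f t)^-1 = (f x)^-1 * (f t)^-1 * (f t - f x).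
    by field; rewrite !f0.
  rewrite !normrM -[leRHS]mulrA; apply: ler_pM => //.
  - by rewrite ler_pM ?iC.
  - by rewrite distrC fC.
- have [f' ff' hf'] := hol_deriv hf.
  exists (fun x => - 1 * ((f x)^-1 * (f x)^-1) * f' x).
    move=> x xab; rewrite mulN1r -invfM -expr2.
    exact: is_deriveV (f0 x xab) (ff' x xab).
  have hi := IH (hol_pred hf).
  by apply: hol_mul => //; apply: hol_mul; [exact: hol_cst|exact: hol_mul].
Qed.

Lemma hol_comp a b c d n f tau (K : R) :
  (forall x, x \in `]c, d[ -> tau x \in `]a, b[) ->
  (forall x t, x \in `]c, d[ -> t \in `]c, d[ -> `|tau x - tau t| <= K * `|x - t|) ->
  hol al a b n f -> hol al c d n tau -> hol al c d n (fun x => f (tau x)).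
Proof.
move=> tab tK; elim: n f => [|n IH] f hf ht; have [C C0 fC] := hol_bounded hf;
  split; try by exists C => x /tab /fC.
- have [C' C'0 fC'] := hol0_modulus hf.
  exists (C' * (Num.max 0 K) `^ al) => x t xcd tcd.
  apply: (le_trans (fC' _ _ (tab _ xcd) (tab _ tcd))).
  have K0 : 0 <= Num.max 0 K by rewrite le_max lexx.
  rewrite -mulrA ler_wpM2l // -powRM //.
  apply: ge0_ler_powR; rewrite ?nnegrE ?mulr_ge0 ?(ltW al0) //.
  apply: (le_trans (tK _ _ xcd tcd)).
  by rewrite ler_wpM2r // le_max lexx orbT.
- have [f' ff' hf'] := hol_deriv hf; have [t' tt' ht'] := hol_deriv ht.
  exists (fun x => f' (tau x) * t' x).
    by move=> x xcd; apply: is_derive1_comp; [apply: ff'; exact: tab|exact: tt'].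
  by apply: hol_mul => //; apply: IH => //; exact: hol_pred.
Qed.

(** Bootstrap for an autonomous equation tau' = F(tau): each pass through
    the equation gains one derivative, up to one more than [F] has. *)
Lemma hol_ode a b c d n F tau (K : R) :
  (forall x, x \in `]c, d[ -> tau x \in `]a, b[) ->
  (forall x t, x \in `]c, d[ -> t \in `]c, d[ -> `|tau x - tau t| <= K * `|x - t|) ->
  hol al a b n F ->
  (forall x, x \in `]c, d[ -> is_derive x 1 tau (F (tau x))) ->
  hol al c d n.+1 tau.
Proof.
move=> tab tK hF tF.
have tb : exists C, forall x, x \in `]c, d[ -> `|tau x| <= C.
  have [C _ idC] := hol_bounded (hol_id a b 0).
  by exists C => x /tab /idC.
have step m : (m <= n)%N -> hol al c d m tau -> hol al c d m.+1 tau.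
  move=> mn ht; split => //; exists (fun x => F (tau x)) => //.
  exact: hol_comp tab tK (hol_le mn hF) ht.
suff main m : (m <= n)%N -> hol al c d m.+1 tau by exact: main.
elim: m => [_|m IH mn]; last by apply: step => //; apply: IH; exact: ltnW.
apply: step => //; split => //.
apply: (@derive_bounded_modulus _ _ _ (fun x => F (tau x))) => //.
by have [C _ FC] := hol_bounded hF; exists C => x /tab /FC.
Qed.

End HolderFunctions.

(** * Iterated derivatives and Hölder norms *)

Section HolderClass.
Context {R : realType}.
Implicit Types (s a b : R) (f : R -> R).

(** The witnesses are unique on the open interval, where they are therefore the
    iterated derivatives. *)
Lemma hol_derive1n (al a b : R) n f : hol al a b n f ->
  exists D : nat -> R -> R,
   [/\ forall j x, (j <= n)%N -> x \in `]a, b[ -> derive1n j f x = D j x,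
       forall j x, (j < n)%N -> x \in `]a, b[ -> is_derive x 1 (D j) (D j.+1 x)
     & forall j, (j <= n)%N -> hol al a b (n - j) (D j)].
Proof.
elim: n f => [|n IH] f hf.
  exists (fun=> f); split => [j x|//|j]; rewrite leqn0 => /eqP -> //.
have [g fg hg] := hol_deriv hf.
have [D [gD DD hD]] := IH g hg.
pose D' j := if j is i.+1 then D i else f.
have D0 x : x \in `]a, b[ -> g x = D 0 x by move=> xab; rewrite -gD.
have dD j x : (j < n.+1)%N -> x \in `]a, b[ -> is_derive x 1 (D' j) (D' j.+1 x).
  case: j => [_ xab|j jn xab] /=; last exact: DD.
  by rewrite -D0 //; exact: fg.
exists D'; split => //; last by case=> // j /hD.
elim=> [//|j IHj] x jn xab.
rewrite derive1nS derive1E.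
have := dD j x jn xab => dDj.
have e : \near x, derive1n j f x = D' j x.
  by have := near_in_itvoo xab; apply: filterS => y yab; apply: IHj => //; exact: ltnW.
have [_ <-] := dDj; apply: near_eq_derive => //.
Qed.

Lemma holder_order_exponent s : 1 < s ->
  [/\ (0 < holder_order s)%N, 0 < s - (holder_order s)%:R &
      s - (holder_order s)%:R <= 1].
Proof.
move=> s1; have s0 : 0 <= s by rewrite (le_trans ler01) // ltW.
have /andP[t1 t2] := truncn_itv s0.
rewrite /holder_order; case: ifPn => si.
  have st : s = (Num.truncn s)%:R.
    by rewrite truncnK // natrEint si.
  have t1' : (1 < Num.truncn s)%N by rewrite -(ltr_nat R) -st.
  have e : (Num.truncn s).-1%:R = s - 1 :> R.
    by rewrite -subn1 natrB -?st // ltnW.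
  rewrite e; split; last by lra.
  - by case: (Num.truncn s) t1' => [|[]].
  - by lra.
have ne : s != (Num.truncn s)%:R by apply: contra si => /eqP ->; exact: intr_nat.
have t0 : (0 < Num.truncn s)%N by rewrite truncn_gt0 ltW.
split => //.
  by rewrite subr_gt0 lt_neqAle eq_sym ne.
by move: t2; rewrite -natr1 => ?; lra.
Qed.

(** Differentiability on a larger open interval yields continuity up to the
    endpoints of [[a, b]]. *)
Lemma hol_holder_class s a b c d f : 1 < s -> c < a -> a < b -> b < d ->
  hol (s - (holder_order s)%:R) c d (holder_order s) f -> holder_class s a b f.
Proof.
move=> s1 ca ab bd hf.
have [m0 al0 al1] := holder_order_exponent s1.
set al := s - _ in hf al0 al1; set m := holder_order s in hf m0 *.
have sub : `[a, b] `<=` `]c, d[.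
  move=> x /=; rewrite !in_itv /= => /andP[ax xb].
  by rewrite (lt_le_trans ca ax) (le_lt_trans xb bd).
have hf' : hol al a b m f.
  by apply: hol_subset hf => x /= xab; apply: sub; apply: subset_itv_oo_cc.
have [D [fD DD hD]] := hol_derive1n hf'.
split.
- apply: derivable_within_continuous => x /sub xcd.
  have /hol_deriv[g fg _] : hol al c d m.-1.+1 f by rewrite prednK.
  by have := fg x xcd => h; exact: ex_derive.
- move=> j x jm xab; have := DD j x jm xab => dj.
  apply: (@near_eq_derivable _ _ _ (D j)); last exact: ex_derive.
  have := near_in_itvoo xab; apply: filterS => y yab.
  by rewrite fD // ltnW.
- have /choice[B DB] : forall j, exists B : R, forall x, (j <= m)%N ->
      x \in `]a, b[ -> `|D j x| <= B.
    move=> j.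
    have [jm|jm] := leqP j m; last by exists 0.
    by have [C _ DC] := hol_bounded (hD j jm); exists C => x _ /DC.
  have hm : hol al a b 0 (D m) by have := hD m (leqnn m); rewrite subnn.
  have [K K0 DK] := hol0_modulus hm.
  rewrite /holder_norm -/m; apply: (@le_lt_trans _ _ ((\sum_(j < m.+1) `|B j|)%:E + K%:E)%E).
    apply: leeD.
      apply: ge_ereal_sup => _ [j jm [x xab ->]].
      rewrite lee_fin fD //; apply: (le_trans (DB _ _ jm xab)).
      rewrite (bigD1 (Ordinal (jm : (j < m.+1)%N))) //=.
      by apply: (le_trans (ler_norm _)); rewrite lerDl sumr_ge0.
    apply: ge_ereal_sup => _ [x [t [xab tab xt ->]]].
    have d0 : 0 < `|x - t| by rewrite normr_gt0 subr_eq0.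
    rewrite lee_fin !fD // -[m%:R - s]opprB powRN mulrC ler_pdivrMr ?powR_gt0 //.
    exact: DK.
  by rewrite -EFinD ltry.
Qed.

(** Both suprema are nonnegative, as the interval has two distinct points, so
    that a bound on their sum bounds each of them. *)
Lemma holder_norm_le s a b f (M : R) : a < b ->
  (holder_norm s a b f <= M%:E)%E ->
  (forall j x, (j <= holder_order s)%N -> x \in `]a, b[ -> `|derive1n j f x| <= M) /\
  (forall x t, x \in `]a, b[ -> t \in `]a, b[ ->
    `|derive1n (holder_order s) f x - derive1n (holder_order s) f t|
      <= M * `|x - t| `^ (s - (holder_order s)%:R)).
Proof.
move=> ab; rewrite /holder_norm.
set A := [set r | _]; set B := [set r | _] => h.
have mab := mid_in_itvoo ab.
pose x0 := (a + b) / 2; pose t0 := (a + x0) / 2.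
have ax0 : a < x0 by move: mab; rewrite in_itv => /andP[].
have tab : t0 \in `]a, b[.
  rewrite in_itv /= /t0; move: mab; rewrite in_itv /= -/x0 => /andP[? ?].
  by apply/andP; split; lra.
have xt0 : x0 != t0 by rewrite gt_eqF // /t0; lra.
have A0 : (0 <= ereal_sup A)%E.
  apply: (@le_trans _ _ (`|derive1n 0 f x0|%:E)); first by rewrite lee_fin.
  by apply: ereal_sup_ubound; exists 0%N => //; exists x0.
have B0 : (0 <= ereal_sup B)%E.
  apply: (@le_trans _ _ ((`|x0 - t0| `^ ((holder_order s)%:R - s)
           * `|derive1n (holder_order s) f x0 - derive1n (holder_order s) f t0|)%:E)).
    by rewrite lee_fin mulr_ge0 // powR_ge0.
  by apply: ereal_sup_ubound; exists x0, t0.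
split=> [j x jm xab|x t xab tab'].
  rewrite -lee_fin; apply: le_trans h.
  apply: (@le_trans _ _ (ereal_sup A)); last by rewrite leeDl.
  by apply: ereal_sup_ubound; exists j => //; exists x.
have [->|xt] := eqVneq x t.
  rewrite !subrr normr0 mulr_ge0 ?powR_ge0 //.
  by rewrite -lee_fin (le_trans _ h) // adde_ge0.
have d0 : 0 < `|x - t| by rewrite normr_gt0 subr_eq0.
rewrite -ler_pdivrMr ?powR_gt0 // -powRN opprB mulrC -lee_fin; apply: le_trans h.
apply: (@le_trans _ _ (ereal_sup B)); last by rewrite leeDr.
by apply: ereal_sup_ubound; exists x, t.
Qed.

Lemma holder_class_hol s a b f (M : R) : a < b ->
  holder_class s a b f -> (holder_norm s a b f <= M%:E)%E ->
  forall j, (j <= holder_order s)%N ->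
  hol (s - (holder_order s)%:R) a b (holder_order s - j) (derive1n j f).
Proof.
move=> ab [_ df _] /(holder_norm_le ab)[bf mf] j.
set m := holder_order s in df bf mf *.
move: {2}(m - j)%N (erefl (m - j)%N) => n; elim: n j => [|n IH] j e jm.
  have -> : j = m by lia.
  rewrite subnn; split; first by exists M => x; exact: bf.
  by exists M.
have jm' : (j < m)%N by lia.
have {}e : (m - j.+1)%N = n by lia.
have -> : (m - j)%N = (m - j.+1).+1 by lia.
split; first by exists M => x; exact: bf.
exists (derive1n j.+1 f); last exact: IH.
move=> x xab; rewrite derive1nS derive1E.
by apply/derivableP; exact: df.
Qed.
End HolderClass.

(** * The implicit function theorem along a nearly flat curve *)

Lemma is_derive_affine {R : realType} (c e y0 y : R) :
  is_derive y 1 (fun z => c + e * (z - y0)) e.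
Proof.
apply/is_derive1_caratheodory; exists (fun=> e); split => //; first by move=> z; ring.
exact: cst_continuous.
Qed.

Lemma near_linear_sign {R : realType} (eta n l d : R) : eta < n ->
  `|l - n * d| <= eta * `|d| -> l <= 0 <-> d <= 0.
Proof.
move=> en; have [d0|d0] := leP d 0.
  rewrite (ler0_norm d0) => /ler_normlW h; split => // _.
  have : 0 <= (n - eta) * (- d) by rewrite mulr_ge0 ?oppr_ge0 // subr_ge0 ltW.
  by move=> ?; lra.
rewrite (gtr0_norm d0) ler_norml => /andP[h _]; split => // l0.
have : 0 < (n - eta) * d by rewrite mulr_gt0 // subr_gt0.
by move=> ?; lra.
Qed.

Lemma cone_signs {R : realType} (v1 v2 w aw m eta up down : R) :
  `|v1 * w| <= `|v1| * aw ->
  (`|v1| + eta + m * eta) * aw <= m * `|v2| * aw ->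
  `|up - (v1 * w + v2 * (m * aw))| <= eta * (aw + m * aw) ->
  `|down - (v1 * w + v2 * - (m * aw))| <= eta * (aw + m * aw) ->
  Num.min down up <= 0 <= Num.max down up.
Proof.
rewrite ge_min le_max (ler_norml _ (_ * aw)) !(ler_norml _ (eta * _)).
have [v2p|v2n] := leP 0 v2.
  rewrite (ger0_norm v2p) => /andP[? ?] ? /andP[? ?] /andP[? ?].
  by apply/andP; split; apply/orP; [left|right]; lra.
rewrite (ltr0_norm v2n) => /andP[? ?] ? /andP[? ?] /andP[? ?].
by apply/andP; split; apply/orP; [right|left]; lra.
Qed.

Section NearlyFlatCurve.
Context {R : realType}.
Variables (psi dpsi : R -> R) (p eta rho : R) (e11 e12 e21 e22 x0 y0 : R).
Hypotheses (n1 : e11 * e11 + e12 * e12 = 1) (n2 : e21 * e21 + e22 * e22 = 1)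
  (o12 : e11 * e21 + e12 * e22 = 0).
Hypothesis rho0 : 0 < rho.
Hypothesis psi0 : psi 0 = 0.
Hypothesis psiD : forall t : R, t \in `](- rho), rho[ -> is_derive t 1 psi (dpsi t).
Hypothesis dpsi_near : forall t : R, t \in `](- rho), rho[ -> `|dpsi t - p| <= eta.

Definition tangent_coord (x y : R) := e11 * (x - x0) + e12 * (y - y0).
Definition normal_coord (x y : R) := e21 * (x - x0) + e22 * (y - y0).

(** The curve [z2 = psi z1] is the zero set of [level], and the domain below
    it, in the rotated frame, is where [level] is nonpositive. *)
Definition level (x y : R) := normal_coord x y - psi (tangent_coord x y).

(** [(nu1, nu2)] is the gradient that [level] would have if [psi] had the
    constant slope [p]. *)
Definition nu1 := e21 - p * e11.
Definition nu2 := e22 - p * e12.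

Lemma frame_coef_le1 : `|e11| <= 1 /\ `|e12| <= 1.
Proof. by split; rewrite -(@expr_le1 _ 2) // expr2 -normrM ger0_norm -?expr2 ?sqr_ge0 //
  -n1 -!expr2 ?lerDl ?lerDr sqr_ge0.
Qed.

Lemma eta_ge0 : 0 <= eta.
Proof.
apply: le_trans (normr_ge0 _) (dpsi_near (_ : 0 \in _)).
by rewrite in_itv /= oppr_lt0 rho0.
Qed.

Lemma tangent_coord_le x y x' y' :
  `|tangent_coord x y - tangent_coord x' y'| <= `|x - x'| + `|y - y'|.
Proof.
have [le1 le2] := frame_coef_le1.
have -> : tangent_coord x y - tangent_coord x' y' =
  e11 * (x - x') + e12 * (y - y') by rewrite /tangent_coord; ring.
apply: (le_trans (ler_normD _ _)); rewrite !normrM.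
by apply: lerD; rewrite ler_piMl.
Qed.

Lemma tangent_coord_window x y : `|x - x0| + `|y - y0| < rho ->
  tangent_coord x y \in `](- rho), rho[.
Proof.
move=> lt; rewrite in_itv /= -ltr_norml; apply: le_lt_trans lt.
have := tangent_coord_le x y x0 y0.
by rewrite [tangent_coord x0 y0]/tangent_coord !subrr !mulr0 addr0 subr0.
Qed.

Lemma level0 : level x0 y0 = 0.
Proof.
by rewrite /level /normal_coord /tangent_coord !subrr !mulr0 addr0 psi0 subr0.
Qed.

(** Bounding increments, rather than values, makes [level] strictly monotone in
    every direction that is not nearly tangent. *)
Lemma level_near_linear x y x' y' :
  `|x - x0| + `|y - y0| < rho -> `|x' - x0| + `|y' - y0| < rho ->
  `|level x y - level x' y' - (nu1 * (x - x') + nu2 * (y - y'))|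
    <= eta * (`|x - x'| + `|y - y'|).
Proof.
move=> /tangent_coord_window w /tangent_coord_window w'.
have := derive_near_affine psiD dpsi_near w w'.
set t := tangent_coord x y; set t' := tangent_coord x' y' => lin.
have -> : level x y - level x' y' - (nu1 * (x - x') + nu2 * (y - y')) =
    - (psi t - psi t' - p * (t - t')).
  by rewrite /level /t /t' /nu1 /nu2 /normal_coord /tangent_coord; ring.
rewrite normrN; apply: (le_trans lin).
by rewrite ler_wpM2l ?eta_ge0 ?tangent_coord_le.
Qed.

(** The normal is [e2 - p e1], hence at least as long as [e2]. *)
Lemma normal_large : 1 <= `|nu1| + `|nu2|.
Proof.
have h : 1 <= `|nu1| ^+ 2 + `|nu2| ^+ 2.
  rewrite !real_normK ?num_real //.
  have -> : nu1 ^+ 2 + nu2 ^+ 2 = 1 + p ^+ 2.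
    rewrite /nu1 /nu2; transitivity (e21 * e21 + e22 * e22
      - 2 * p * (e11 * e21 + e12 * e22) + p ^+ 2 * (e11 * e11 + e12 * e12)).
      by ring.
    by rewrite n1 n2 o12; ring.
  by rewrite lerDl sqr_ge0.
have := normr_ge0 nu1; have := normr_ge0 nu2; nra.
Qed.

Lemma level_le0_above x y z : eta < nu2 ->
  `|x - x0| + `|y - y0| < rho -> `|x - x0| + `|z - y0| < rho ->
  level x z = 0 -> level x y <= 0 <-> y <= z.
Proof.
move=> nu w w' lz.
have := level_near_linear w w'; rewrite lz subrr mulr0 add0r subr0 normr0 add0r.
by move=> /(near_linear_sign nu) ->; rewrite subr_le0.
Qed.

Lemma level_le0_below x y z : nu2 < - eta ->
  `|x - x0| + `|y - y0| < rho -> `|x - x0| + `|z - y0| < rho ->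
  level x z = 0 -> level x y <= 0 <-> z <= y.
Proof.
move=> nu w w' lz; rewrite ltrNr in nu.
have := level_near_linear w w'; rewrite lz subrr mulr0 add0r subr0 normr0 add0r.
rewrite [`|y - z|]distrC -[y - z]opprB mulrN -mulNr.
by move=> /(near_linear_sign nu) ->; rewrite subr_le0.
Qed.

Variables (m L : R).
Hypotheses (m0 : 0 < m) (flat : `|nu1| + eta + m * eta < m * `|nu2|).
Hypothesis window : (1 + m) * L <= rho.

Lemma flat_eta_lt : eta < `|nu2|.
Proof. by have := normr_ge0 nu1; have := eta_ge0; move: flat m0; nra. Qed.

Lemma cone_window x y : `|x - x0| < L -> `|y - y0| <= m * `|x - x0| ->
  `|x - x0| + `|y - y0| < rho.
Proof. by move=> xL yx; have := normr_ge0 (x - x0); move: m0 window; nra. Qed.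

(** On the two sides of the cone of slope [m] with apex [(x0, y0)], [level] has
    opposite signs, by [flat]; the intermediate value theorem on the vertical
    segment between them gives a zero in the cone. *)
Lemma level_zero_exists x : `|x - x0| < L ->
  exists2 y, `|y - y0| <= m * `|x - x0| & level x y = 0.
Proof.
move=> xL; set d := m * `|x - x0|.
have d0 : 0 <= d by rewrite mulr_ge0 // ltW.
have in_cone y : y \in `[y0 - d, y0 + d] -> `|y - y0| <= d.
  by rewrite in_itv /= => /andP[? ?]; rewrite ler_norml; apply/andP; split; lra.
have cont : {within `[y0 - d, y0 + d], continuous (level x)}.
  apply: derivable_within_continuous => y /in_cone yd.
  have /psiD dp := tangent_coord_window (cone_window xL yd).
  have dz := is_derive_affine (e11 * (x - x0)) e12 y0 y.
  have dn := is_derive_affine (e21 * (x - x0)) e22 y0 y.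
  have dc := is_derive1_comp dp dz.
  have dl := is_deriveB dn dc.
  exact: (@ex_derive _ _ _ _ _ _ _ dl).
have bounds (sg : R) : `|sg| = 1 ->
    `|level x (y0 + sg * d) - (nu1 * (x - x0) + nu2 * (sg * d))|
    <= eta * (`|x - x0| + d).
  move=> sg1.
  have e0 : y0 + sg * d - y0 = sg * d by ring.
  have e : `|y0 + sg * d - y0| = d by rewrite e0 normrM sg1 mul1r ger0_norm.
  have w : `|x - x0| + `|y0 + sg * d - y0| < rho by apply: cone_window; rewrite ?e.
  have w0 : `|x0 - x0| + `|y0 - y0| < rho by rewrite !subrr normr0 addr0.
  have := level_near_linear w w0.
  by rewrite level0 subr0 e e0.
have b1 := bounds 1 (normr1 _); have b2 := bounds (-1) (normrN1 _).
have f1 : `|nu1 * (x - x0)| <= `|nu1| * `|x - x0| by rewrite normrM.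
have n0 := normr_ge0 (x - x0).
have fl : (`|nu1| + eta + m * eta) * `|x - x0| <= m * `|nu2| * `|x - x0|.
  by rewrite ler_wpM2r // ltW.
have [y yd ly] : exists2 y, y \in `[y0 - d, y0 + d] & level x y = 0.
  apply: IVT => //; first by lra.
  by move: b1 b2; rewrite mulN1r mul1r; exact: cone_signs f1 fl.
by exists y => //; exact: in_cone.
Qed.

Lemma level_zero_function : exists phi : R -> R,
  forall x, `|x - x0| < L ->
    `|phi x - y0| <= m * `|x - x0| /\ level x (phi x) = 0.
Proof.
have /choice[phi phiE] : forall x, exists y, `|x - x0| < L ->
    `|y - y0| <= m * `|x - x0| /\ level x y = 0.
  move=> x.
  have [/level_zero_exists[y yd ly]|xL] := ltP `|x - x0| L; first by exists y.
  by exists 0.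
by exists phi.
Qed.

(** A 2 x 2 orthonormal frame is a rotation, possibly followed by a
    reflection; [d] is its determinant. *)
Lemma frame_determinant : exists d : R,
  [/\ d * d = 1, e22 = d * e11 & e21 = - d * e12].
Proof.
exists (e11 * e22 - e12 * e21); split.
- transitivity ((e11 * e11 + e12 * e12) * (e21 * e21 + e22 * e22)
    - (e11 * e21 + e12 * e22) * (e11 * e21 + e12 * e22)); first by ring.
  by rewrite n1 n2 o12; ring.
- transitivity ((e11 * e11 + e12 * e12) * e22
    - (e11 * e21 + e12 * e22) * e12); last by ring.
  by rewrite n1 o12; ring.
- transitivity ((e11 * e11 + e12 * e12) * e21
    - (e11 * e21 + e12 * e22) * e11); last by ring.
  by rewrite n1 o12; ring.
Qed.

Lemma frame_columns :
  [/\ e11 * e11 + e21 * e21 = 1, e12 * e12 + e22 * e22 = 1,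
      e11 * e12 + e21 * e22 = 0 & `|e11 + p * e21| = `|nu2| ].
Proof.
have [d [d1 d22 d21]] := frame_determinant; rewrite /nu2 d22 d21; split.
- by transitivity (e11 * e11 + d * d * (e12 * e12)); [ring|rewrite d1 mul1r].
- by transitivity (e12 * e12 + d * d * (e11 * e11));
    [ring|rewrite d1 mul1r addrC].
- by transitivity (e11 * e12 * (1 - d * d)); [ring|rewrite d1 subrr mulr0].
- have nd : `|d| = 1.
    by apply/eqP; rewrite -(@pexpr_eq1 _ _ 2) // expr2 -normrM d1 normr1.
  rewrite -[LHS]mul1r -nd -normrM; congr (`|_|).
  by transitivity (d * e11 - p * (d * d * e12)); [ring|rewrite d1 mul1r].
Qed.

Let X (t : R) := x0 + (e11 * t + e21 * psi t).
Let Y (t : R) := y0 + (e12 * t + e22 * psi t).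
Let dX (t : R) := e11 + e21 * dpsi t.
Let c : R := `|nu2| - eta.

Lemma curve_speed_gt0 : 0 < c. Proof. by rewrite subr_gt0 flat_eta_lt. Qed.

Lemma frame_coef21_le1 : `|e21| <= 1.
Proof.
have [nn _ _ _] := frame_columns.
by rewrite -(@expr_le1 _ 2) // expr2 -normrM ger0_norm -?expr2 ?sqr_ge0 // -nn
  -!expr2 lerDr sqr_ge0.
Qed.

Lemma curve_abscissa_derive (t : R) : t \in `](- rho), rho[ ->
  is_derive t 1 X (dX t).
Proof.
move=> /psiD dp.
have dz := is_derive_affine x0 e11 0 t.
have -> : X = (fun z => x0 + e11 * (z - 0)) + e21 \*: psi.
  apply/funext => z; change (X z = x0 + e11 * (z - 0) + e21 * psi z).
  by rewrite /X; ring.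
exact: is_deriveD dz (is_deriveZ e21 dp).
Qed.

(** The tangent [e1 + p e2] is the normal [e2 - p e1] turned by a right angle,
    so the abscissa of one is, up to sign, the ordinate [nu2] of the other. *)
Lemma curve_speed_ge (t : R) : t \in `](- rho), rho[ -> c <= `|dX t|.
Proof.
move=> /dpsi_near h; have [_ _ _ e] := frame_columns.
have -> : dX t = (e11 + p * e21) + e21 * (dpsi t - p) by rewrite /dX; ring.
rewrite /c -e lerBlDr.
apply: (@le_trans _ _ (`|e11 + p * e21 + e21 * (dpsi t - p)| + `|e21 * (dpsi t - p)|)).
  by rewrite -[X in `|X| <= _](addrK (e21 * (dpsi t - p))) ler_normB.
rewrite lerD2l normrM; apply: le_trans h.
by rewrite ler_piMl // frame_coef21_le1.
Qed.

Lemma curve_abscissa_inverse_lipschitz (t t' : R) :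
  t \in `](- rho), rho[ -> t' \in `](- rho), rho[ ->
  `|t - t'| <= c^-1 * `|X t - X t'|.
Proof.
move=> w w'; rewrite mulrC ler_pdivlMr ?curve_speed_gt0 // mulrC.
have lin := derive_near_affine psiD dpsi_near w w'.
have [_ _ _ e] := frame_columns.
have -> : X t - X t' = (e11 + p * e21) * (t - t')
    + e21 * (psi t - psi t' - p * (t - t')) by rewrite /X; ring.
rewrite /c -e mulrBl lerBlDr -normrM.
set u := _ * (t - t'); set v := _ * (psi t - _ - _).
apply: (@le_trans _ _ (`|u + v| + `|v|)).
  by rewrite -[X in `|X| <= _](addrK v) ler_normB.
rewrite lerD2l /v normrM; apply: le_trans lin.
by rewrite ler_piMl // frame_coef21_le1.
Qed.

Variables (al : R) (n : nat).
Hypotheses (al0 : 0 < al) (al1 : al <= 1).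
Hypothesis psiH : hol al (- rho) rho n.+1 psi.
Hypothesis dpsiH : hol al (- rho) rho n dpsi.

(** The curve is [t |-> (X t, Y t)] with [X] invertible, so it is the graph of
    [Y \o tau] for the inverse [tau] of [X]; since [tau' = 1 / X' (tau)], the
    inverse is as regular as [X]. *)
Lemma level_zero_graph : exists phi : R -> R,
  (forall x, `|x - x0| < L ->
    `|phi x - y0| <= m * `|x - x0| /\ level x (phi x) = 0) /\
  hol al (x0 - L) (x0 + L) n.+1 phi.
Proof.
have [phi0 phi0E] := level_zero_function.
pose tau x := tangent_coord x (phi0 x).
have [c1 c2 c12 _] := frame_columns.
have xL x : x \in `](x0 - L), (x0 + L)[ -> `|x - x0| < L.
  by rewrite in_itv /= => /andP[? ?]; rewrite ltr_norml; apply/andP; split; lra.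
have tauW x : `|x - x0| < L -> tau x \in `](- rho), rho[.
  by move=> h; apply: tangent_coord_window; apply: cone_window => //;
    case: (phi0E x h).
have nE x : `|x - x0| < L -> psi (tau x) = normal_coord x (phi0 x).
  by case/phi0E=> _ /eqP; rewrite subr_eq0 => /eqP.
have XtauE x : `|x - x0| < L -> X (tau x) = x.
  move=> /nE e; rewrite /X e /tau /tangent_coord /normal_coord.
  transitivity (x0 + (e11 * e11 + e21 * e21) * (x - x0)
    + (e11 * e12 + e21 * e22) * (phi0 x - y0)); first by ring.
  by rewrite c1 c12; ring.
have YtauE x : `|x - x0| < L -> Y (tau x) = phi0 x.
  move=> /nE e; rewrite /Y e /tau /tangent_coord /normal_coord.
  transitivity (y0 + (e12 * e12 + e22 * e22) * (phi0 x - y0)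
    + (e11 * e12 + e21 * e22) * (x - x0)); first by ring.
  by rewrite c2 c12; ring.
have tauL x t : x \in `](x0 - L), (x0 + L)[ -> t \in `](x0 - L), (x0 + L)[ ->
    `|tau x - tau t| <= c^-1 * `|x - t|.
  move=> /xL hx /xL ht; rewrite -[in leRHS](XtauE x hx) -[in leRHS](XtauE t ht).
  by apply: curve_abscissa_inverse_lipschitz; exact: tauW.
have tauD x : x \in `](x0 - L), (x0 + L)[ -> is_derive x 1 tau (dX (tau x))^-1.
  move=> xi; have hx := xL x xi; have tw := tauW x hx.
  rewrite -{1}(XtauE x hx); apply: is_derive_inverse.
  - have dx := curve_abscissa_derive tw.
    have cX : {for tau x, continuous X}.
      by apply: differentiable_continuous; apply/derivable1_diffP; exact: ex_derive.
    have nx : \forall z \near X (tau x), z \in `](x0 - L), (x0 + L)[.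
      by rewrite XtauE //; exact: near_in_itvoo.
    have := cX _ nx; have := near_in_itvoo tw; apply: filterS2 => t tW /= /xL Xt.
    apply/eqP; rewrite -subr_eq0 -normr_le0.
    apply: le_trans (curve_abscissa_inverse_lipschitz (tauW _ Xt) tW) _.
    by rewrite XtauE // subrr normr0 mulr0.
  - have := near_in_itvoo tw; apply: filterS => t /curve_abscissa_derive dx.
    by apply: differentiable_continuous; apply/derivable1_diffP; exact: ex_derive.
  - exact: curve_abscissa_derive.
  - by rewrite -normr_gt0; apply: lt_le_trans (curve_speed_ge tw); exact: curve_speed_gt0.
have tauI x : x \in `](x0 - L), (x0 + L)[ -> tau x \in `](- rho), rho[.
  by move=> /xL /tauW.
have hX : hol al (- rho) rho n (fun t => (dX t)^-1).
  apply: (hol_inv al1 (f := dX) curve_speed_gt0 curve_speed_ge).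
  exact: (hol_add (hol_cst _ _ _ _ e11)
    (hol_mul al1 (hol_cst _ _ _ _ e21) dpsiH)).
have hY : hol al (- rho) rho n.+1 Y.
  apply: (hol_add (hol_cst _ _ _ _ y0)).
  exact: (hol_add (hol_mul al1 (hol_cst _ _ _ _ e12) (hol_id al1 _ _ _))
    (hol_mul al1 (hol_cst _ _ _ _ e22) psiH)).
exists (fun x => Y (tau x)); split.
  by move=> x hx; rewrite YtauE //; exact: phi0E.
apply: (hol_comp al0 al1 (f := Y) tauI tauL hY).
exact: (hol_ode al0 al1 tauI tauL hX).
Qed.

End NearlyFlatCurve.

(** * Cell averages under translation *)

Section Translation.
Context {R : realType}.
Local Notation mu := (@lebesgue_measure R).

Definition shift2 (v z : R * R) : R * R := (z.1 + v.1, z.2 + v.2).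

Lemma measurable_addr (v : R) :
  measurable_fun setT ((fun x => x + v) : measurableTypeR R -> measurableTypeR R).
Proof.
by apply: measurable_funD => //; exact: measurable_cst.
Qed.

Lemma preimage_addr_itv (v : R) b1 b2 (x y : R) :
  (fun z => z + v) @^-1` [set` Interval (BSide b1 x) (BSide b2 y)] =
  [set` Interval (BSide b1 (x - v)) (BSide b2 (y - v))].
Proof.
by apply/seteqP; split => z /=; rewrite !in_itv /=; case: b1; case: b2;
  rewrite /= ?lerBlDr ?ltrBlDr ?lerBrDr ?ltrBrDr.
Qed.

(** The translated measure agrees with the Lebesgue measure on intervals, which
    determine it; in the plane, rectangles play the same part. *)
Lemma lebesgue_measure_translation (v : R) (A : set (measurableTypeR R)) :
  measurable A ->
  mu ((fun x : measurableTypeR R => x + v) @^-1` A) = mu A.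
Proof.
move=> mA; have mf := measurable_addr v.
apply/esym.
apply: (lebesgue_measure_unique (mu := pushforward mu
  ((fun x => x + v) : measurableTypeR R -> measurableTypeR R))) => //.
move=> _ [[a b]] _ <-.
transitivity (mu [set` `]a - v, b - v]]); last first.
  by rewrite -(preimage_addr_itv v false false a b).
by rewrite !lebesgue_measure_itv /= !lte_fin ltrD2r -!EFinB opprB addrA subrK.
Qed.

Lemma measurable_shift2 (v : R * R) : measurable_fun setT
  (shift2 v : measurableTypeR R * measurableTypeR R ->
              measurableTypeR R * measurableTypeR R).
Proof.
apply: measurable_fun_pair.
  exact: measurableT_comp (measurable_addr v.1) measurable_fst.
exact: measurableT_comp (measurable_addr v.2) measurable_snd.
Qed.

Lemma measurable_shift2_preimage (v : R * R)
    (A : set (measurableTypeR R * measurableTypeR R)) :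
  measurable A ->
  measurable (shift2 v @^-1` A : set (measurableTypeR R * measurableTypeR R)).
Proof.
by move=> mA; rewrite -[X in measurable X]setTI; exact: measurable_shift2.
Qed.

Lemma lebesgue2_translation (v : R * R)
    (A : set (measurableTypeR R * measurableTypeR R)) :
  measurable A -> lebesgue2 R (shift2 v @^-1` A) = lebesgue2 R A.
Proof.
move=> mA; have mf := measurable_shift2 v.
apply/esym; rewrite /lebesgue2.
apply: (product_measure_unique (m' := pushforward (lebesgue2 R)
  (shift2 v : measurableTypeR R * measurableTypeR R ->
                measurableTypeR R * measurableTypeR R))) => // B C mB mC.
transitivity (lebesgue2 R (((fun x : measurableTypeR R => x + v.1) @^-1` B) `*`
   ((fun x : measurableTypeR R => x + v.2) @^-1` C))).
  by [].
rewrite /lebesgue2 /= product_measure1E.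
- by congr (_ * _)%E; exact: lebesgue_measure_translation.
- by rewrite -[X in measurable X]setTI; exact: measurable_addr.
- by rewrite -[X in measurable X]setTI; exact: measurable_addr.
Qed.

Lemma lebesgue2_rectangle (a b c d : R) : a <= b -> c <= d ->
  lebesgue2 R (`[a, b] `*` `[c, d]) = ((b - a) * (d - c))%:E.
Proof.
move=> ab cd; rewrite /lebesgue2 /= product_measure1E //=.
rewrite EFinM; congr (_ * _)%E.
  rewrite lebesgue_measure_itv /= lte_fin EFinB.
  by case: ltgtP ab => // -> _; rewrite -EFinB subrr.
rewrite lebesgue_measure_itv /= lte_fin EFinB.
by case: ltgtP cd => // -> _; rewrite -EFinB subrr.
Qed.

Lemma measurable_rectangle (a b c d : R) :
  measurable (`[a, b] `*` `[c, d] : set (measurableTypeR R * measurableTypeR R)).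
Proof. by apply: measurableX. Qed.

End Translation.

Lemma fine_lt_adde {R : realType} (x y : \bar R) (q : R) :
  x \is a fin_num -> y \is a fin_num -> 0 < q -> (x + q%:E <= y)%E ->
  fine x < fine y.
Proof.
move=> xf yf q0; rewrite -{1}(fineK xf) -{1}(fineK yf) -EFinD lee_fin.
by apply: lt_le_trans; rewrite ltrDl.
Qed.

Section CellAverage.
Context {R : realType}.
Implicit Types (Omega T : set (measurableTypeR R * measurableTypeR R)) (h : R).

Lemma cell_average_indic Omega T : measurable T -> measurable (Omega `&` T) ->
  cell_average \1_Omega T =
  (fine (lebesgue2 R T))^-1 * fine (lebesgue2 R (Omega `&` T)).
Proof.
move=> mT mOT; rewrite /cell_average /Rintegral; congr (_ * fine _).
transitivity (\int[lebesgue2 R]_(z in T) (\1_(Omega `&` T) z)%:E)%E.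
  apply: eq_integral => z zT; rewrite !indicE in_setI zT andbT //.
by rewrite (integral_indic _ mT mOT) -setIA setIid.
Qed.

Lemma lebesgue2_cell h (kappa : int * int) : 0 < h ->
  lebesgue2 R (cell h kappa) = (h ^+ 2)%:E.
Proof.
move=> h0; rewrite lebesgue2_rectangle ?ler_pM2l ?ler_int ?lerDl //.
by congr (_%:E); rewrite !intrD; ring.
Qed.

Lemma measurable_cell h (kappa : int * int) :
  measurable (cell h kappa : set (measurableTypeR R * measurableTypeR R)).
Proof. exact: measurable_rectangle. Qed.

Definition lattice_shift h (v : int * int) (z : R * R) : R * R :=
  shift2 (h * v.1%:~R, h * v.2%:~R) z.

Lemma cell_shift h (kappa v : int * int) (z : R * R) :
  cell h (kappa.1 + v.1, kappa.2 + v.2) (lattice_shift h v z) <->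
  cell h kappa z.
Proof.
rewrite /cell /lattice_shift /shift2 /= !in_itv /= !intrD !mulrDr.
by split=> -[/andP[? ?] /andP[? ?]]; split; apply/andP; split; lra.
Qed.

Lemma lebesgue2_cell_fin Omega h (kappa : int * int) : 0 < h ->
  measurable (Omega `&` cell h kappa) ->
  lebesgue2 R (Omega `&` cell h kappa) \is a fin_num.
Proof.
move=> h0 mO; rewrite ge0_fin_numE ?measure_ge0 //.
apply: (@le_lt_trans _ _ (lebesgue2 R (cell h kappa))).
  by apply: le_measure; rewrite ?inE //; exact: measurable_cell.
by rewrite lebesgue2_cell // ltry.
Qed.

Lemma cell_average_cell Omega h (kappa : int * int) : 0 < h ->
  measurable (Omega `&` cell h kappa) ->
  cell_average \1_Omega (cell h kappa) =
  (h ^+ 2)^-1 * fine (lebesgue2 R (Omega `&` cell h kappa)).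
Proof.
move=> h0 mO; rewrite (cell_average_indic (measurable_cell h kappa) mO).
by rewrite (lebesgue2_cell kappa h0).
Qed.

(** If the translation maps the part of the domain lying in a cell into the
    domain, that part has at most the measure of its counterpart in the image
    cell. *)
Lemma cell_average_shift_le Omega h (kappa v : int * int) : 0 < h ->
  measurable (Omega `&` cell h kappa) ->
  measurable (Omega `&` cell h (kappa.1 + v.1, kappa.2 + v.2)) ->
  (forall z, cell h kappa z -> Omega z -> Omega (lattice_shift h v z)) ->
  cell_average \1_Omega (cell h kappa) <=
  cell_average \1_Omega (cell h (kappa.1 + v.1, kappa.2 + v.2)).
Proof.
move=> h0 mT mT' sub.
rewrite (cell_average_cell h0 mT) (cell_average_cell h0 mT').
have hh : 0 < (h ^+ 2)^-1 by rewrite invr_gt0 exprn_gt0.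
rewrite (ler_pM2l hh).
apply: fine_le; [exact: lebesgue2_cell_fin|exact: lebesgue2_cell_fin|].
rewrite -[leRHS](lebesgue2_translation (h * v.1%:~R, h * v.2%:~R) mT').
apply: le_measure; rewrite ?inE //.
  by apply: measurable_shift2_preimage.
by move=> z [Oz Tz]; split; [exact: sub|apply/cell_shift].
Qed.

(** The rectangle lies outside the domain and its image inside, so the image
    cell gains at least its area. *)
Lemma cell_average_shift_lt Omega h (kappa v : int * int) (a b c d : R) : 0 < h ->
  measurable (Omega `&` cell h kappa) ->
  measurable (Omega `&` cell h (kappa.1 + v.1, kappa.2 + v.2)) ->
  (forall z, cell h kappa z -> Omega z -> Omega (lattice_shift h v z)) ->
  a < b -> c < d -> `[a, b] `*` `[c, d] `<=` cell h kappa ->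
  (forall z, (`[a, b] `*` `[c, d]) z -> ~ Omega z /\ Omega (lattice_shift h v z)) ->
  cell_average \1_Omega (cell h kappa) <
  cell_average \1_Omega (cell h (kappa.1 + v.1, kappa.2 + v.2)).
Proof.
move=> h0 mT mT' sub ab cd; set Q := _ `*` _ => QT Qsub.
rewrite (cell_average_cell h0 mT) (cell_average_cell h0 mT').
have hh : 0 < (h ^+ 2)^-1 by rewrite invr_gt0 exprn_gt0.
rewrite (ltr_pM2l hh).
have mQ : measurable (Q : set (measurableTypeR R * measurableTypeR R)).
  exact: measurable_rectangle.
have q0 : 0 < (b - a) * (d - c) by rewrite mulr_gt0 ?subr_gt0.
have finT := lebesgue2_cell_fin h0 mT; have finT' := lebesgue2_cell_fin h0 mT'.
apply: (fine_lt_adde finT finT' q0).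
rewrite -(lebesgue2_rectangle (ltW ab) (ltW cd)) -/Q.
have dis : (Omega `&` cell h kappa) `&` Q = set0.
  by apply/seteqP; split => z //= [[Oz _] /Qsub[]].
rewrite -(measureU _ mT mQ dis).
rewrite -[leRHS](lebesgue2_translation (h * v.1%:~R, h * v.2%:~R) mT').
apply: le_measure; rewrite ?inE.
- exact: measurableU.
- exact: measurable_shift2_preimage.
- move=> z [[Oz Tz]|Qz]; first by split; [exact: sub|apply/cell_shift].
  by split; [have [] := Qsub z Qz|apply/cell_shift; exact: QT].
Qed.
End CellAverage.

(** * The Sobel gradient and the normal of the interface *)

Lemma small_subinterval {R : realType} (lo hi x eps : R) :
  lo < hi -> lo <= x <= hi -> 0 < eps ->
  exists a b, a < b /\ forall y, a <= y <= b -> lo <= y <= hi /\ `|y - x| <= eps.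
Proof.
move=> lh /andP[lx xh] e0.
pose d := Num.min eps ((hi - lo) / 2).
have d0 : 0 < d by rewrite lt_min e0 divr_gt0 // subr_gt0.
have dE : d <= eps by rewrite ge_min lexx.
have dh : d <= (hi - lo) / 2 by rewrite ge_min lexx orbT.
have [xm|xm] := leP x ((lo + hi) / 2).
  exists x, (x + d); split=> [|y /andP[? ?]]; first by lra.
  by split; [apply/andP; split; lra|rewrite ler_norml; apply/andP; split; lra].
exists (x - d), x; split=> [|y /andP[? ?]]; first by lra.
by split; [apply/andP; split; lra|rewrite ler_norml; apply/andP; split; lra].
Qed.

Lemma shift_bound {R : realType} (h : R) (i : int) : 0 < h -> `|i| <= 1 ->
  - h <= h * i%:~R <= h.
Proof.
move=> h0; rewrite ler_norml => /andP[i1 i2]; apply/andP; split.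
  by rewrite -[leLHS]mulrN1 ler_pM2l // -[-1]/((-1)%:~R) ler_int.
by rewrite ger_pMr // lerz1.
Qed.

Lemma index_shift (k i i' : int) : k + i + (i' - i) = k + i'.
Proof. by rewrite -addrA subrKC. Qed.

Lemma norm1_int (q : int) : `|q| = 1 -> q = 1 \/ q = -1.
Proof. by move=> q1; lia. Qed.

Lemma neighbor_dist {R : realType} (h lo t x y : R) : - h <= t <= h ->
  lo <= x <= lo + h -> lo + t <= y <= lo + t + h -> `|y - x| <= 2 * h.
Proof.
move=> /andP[? ?] /andP[? ?] /andP[? ?].
by rewrite ler_norml; apply/andP; split; lra.
Qed.

Lemma margin_gt0 {R : realType} (delta s c g : R) : 0 < delta ->
  delta = - s - c -> - (c + delta / 4) <= g - - s -> 0 < g.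
Proof. by move=> ? ? ?; lra. Qed.

Lemma margin_le0 {R : realType} (delta s c g : R) : 0 < delta ->
  delta = - s - c -> g - s <= c + delta / 4 -> g <= 0.
Proof. by move=> ? ? ?; lra. Qed.

Section SobelSigns.
Context {R : realType}.
Variables (Omega : set (R * R)) (h : R) (kappa : int * int).
Variables (G : R -> R -> R) (nu1 nu2 eta rho x0 y0 : R).
Hypotheses (h0 : 0 < h) (eta0 : 0 <= eta) (stencil_window : 4 * h < rho).
Hypothesis z0T : cell h kappa (x0, y0).
Hypothesis OmegaE : forall x y, `|x - x0| + `|y - y0| < rho ->
  Omega (x, y) <-> G x y <= 0.
Hypothesis G0 : G x0 y0 = 0.
Hypothesis Glin : forall x y x' y',
  `|x - x0| + `|y - y0| < rho -> `|x' - x0| + `|y' - y0| < rho ->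
  `|G x y - G x' y' - (nu1 * (x - x') + nu2 * (y - y'))|
    <= eta * (`|x - x'| + `|y - y'|).
Hypothesis mOmega : forall i j : int, `|i| <= 1 -> `|j| <= 1 ->
  measurable (Omega `&` cell h (kappa.1 + i, kappa.2 + j) :
    set (measurableTypeR R * measurableTypeR R)).

Let a (i j : int) :=
  cell_average \1_Omega (cell h (kappa.1 + i, kappa.2 + j)).

Lemma stencil_cell_window (i j : int) x y : `|i| <= 1 -> `|j| <= 1 ->
  cell h (kappa.1 + i, kappa.2 + j) (x, y) -> `|x - x0| + `|y - y0| < rho.
Proof.
move=> /(shift_bound h0) ib /(shift_bound h0) jb T; apply: le_lt_trans stencil_window.
have -> : 4 * h = 2 * h + 2 * h by ring.
move: z0T T; rewrite /cell /= !in_itv /= !intrD !mulrDr mulr1.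
by move=> [xa ya] [xb yb]; apply: lerD;
  [exact: neighbor_dist ib xa xb|exact: neighbor_dist jb ya yb].
Qed.

Lemma average_shift_sub (i j i' j' : int) z :
  `|i| <= 1 -> `|j| <= 1 -> `|i'| <= 1 -> `|j'| <= 1 ->
  nu1 * (i' - i)%:~R + nu2 * (j' - j)%:~R
    + eta * (`|(i' - i)%:~R| + `|(j' - j)%:~R|) <= 0 ->
  cell h (kappa.1 + i, kappa.2 + j) z -> Omega z ->
  Omega (lattice_shift h (i' - i, j' - j) z).
Proof.
case: z => x y i1 j1 i'1 j'1 dec T.
have w := stencil_cell_window i1 j1 T.
have T' : cell h (kappa.1 + i', kappa.2 + j') (lattice_shift h (i' - i, j' - j) (x, y)).
  have := (cell_shift h (kappa.1 + i, kappa.2 + j) (i' - i, j' - j) (x, y)).2 T.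
  by rewrite /= !index_shift.
have := stencil_cell_window i'1 j'1 T'; rewrite /lattice_shift /shift2 /= => w'.
move=> /(OmegaE w) Gz; apply/(OmegaE w').
have := Glin w' w => /ler_normlW.
have -> : x + h * (i' - i)%:~R - x = h * (i' - i)%:~R by ring.
have -> : y + h * (j' - j)%:~R - y = h * (j' - j)%:~R by ring.
rewrite !normrM (gtr0_norm h0) => l.
set A := (i' - i)%:~R in dec l *; set B := (j' - j)%:~R in dec l *.
have : h * (nu1 * A + nu2 * B + eta * (`|A| + `|B|)) <= 0.
  by rewrite pmulr_rle0.
set u := G _ _ in l *; set v := G x y in l Gz *; move: u v l Gz => u v l Gz ?.
lra.
Qed.

Lemma average_le (i j i' j' : int) :
  `|i| <= 1 -> `|j| <= 1 -> `|i'| <= 1 -> `|j'| <= 1 ->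
  nu1 * (i' - i)%:~R + nu2 * (j' - j)%:~R
    + eta * (`|(i' - i)%:~R| + `|(j' - j)%:~R|) <= 0 -> a i j <= a i' j'.
Proof.
move=> i1 j1 i'1 j'1 dec; rewrite /a.
have := @cell_average_shift_le _ Omega h (kappa.1 + i, kappa.2 + j)
  (i' - i, j' - j) h0 (mOmega i1 j1).
rewrite /= !index_shift.
by apply; [exact: mOmega|move=> z; exact: average_shift_sub].
Qed.

(** The point [(x0, y0)] of the interface is shifted into two opposite cells,
    on either side of the interface; a small rectangle near the first of its
    images, inside the cell, makes the comparison strict. *)
Lemma average_lt (i j : int) : `|i| <= 1 -> `|j| <= 1 ->
  nu1 * i%:~R + nu2 * j%:~R + eta * (`|i%:~R| + `|j%:~R|) < 0 ->
  a (- i) (- j) < a i j.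
Proof.
move=> i1 j1 dec; rewrite /a.
have i1' : `|- i| <= 1 by rewrite normrN.
have j1' : `|- j| <= 1 by rewrite normrN.
have di : (i - - i)%:~R = 2 * i%:~R :> R by rewrite opprK intrD; ring.
have dj : (j - - j)%:~R = 2 * j%:~R :> R by rewrite opprK intrD; ring.
have dec2 : nu1 * (i - - i)%:~R + nu2 * (j - - j)%:~R
    + eta * (`|(i - - i)%:~R| + `|(j - - j)%:~R|) <= 0.
  rewrite di dj !normrM normr_nat.
  have -> : nu1 * (2 * i%:~R) + nu2 * (2 * j%:~R) + eta * (2 * `|i%:~R| + 2 * `|j%:~R|) =
    2 * (nu1 * i%:~R + nu2 * j%:~R + eta * (`|i%:~R| + `|j%:~R|)) by ring.
  by rewrite pmulr_rle0 // ltW.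
pose x1 := x0 - h * i%:~R; pose y1 := y0 - h * j%:~R.
(* [G] is at least [delta] at the first image of [(x0, y0)] and at most
   [- delta] at the second; moving by at most [eps] in each coordinate costs at
   most a quarter of this margin. *)
pose delta : R := - h * (nu1 * i%:~R + nu2 * j%:~R + eta * (`|i%:~R| + `|j%:~R|)).
have delta0 : 0 < delta by rewrite /delta nmulr_rgt0 // oppr_lt0.
pose K : R := `|nu1| + `|nu2| + 2 * eta + 1.
have K0 : 0 < K by rewrite /K ltr_wpDl // !addr_ge0 // mulr_ge0.
pose eps : R := delta / (4 * K).
have eps0 : 0 < eps by rewrite divr_gt0 // mulr_gt0.
have T1 : cell h (kappa.1 - i, kappa.2 - j) (x1, y1).
  have := (cell_shift h kappa (- i, - j) (x0, y0)).2 z0T.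
  by rewrite /lattice_shift /shift2 /= !intrN !mulrN.
have w0 : `|x0 - x0| + `|y0 - y0| < rho.
  by rewrite !subrr normr0 addr0; apply: lt_trans stencil_window; rewrite mulr_gt0.
have [c [d [cd cdP]]] := @small_subinterval R (h * (kappa.1 - i)%:~R)
    (h * (kappa.1 - i + 1)%:~R) x1 eps
    ltac:(by rewrite ltr_pM2l // ltr_int ltrDl)
    ltac:(by case: T1 => /=; rewrite in_itv) eps0.
have [c' [d' [cd' cdP']]] := @small_subinterval R (h * (kappa.2 - j)%:~R)
    (h * (kappa.2 - j + 1)%:~R) y1 eps
    ltac:(by rewrite ltr_pM2l // ltr_int ltrDl)
    ltac:(by case: T1 => _ /=; rewrite in_itv) eps0.
have := @cell_average_shift_lt _ Omega h (kappa.1 - i, kappa.2 - j) (i - - i, j - - j)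
  c d c' d' h0 (mOmega i1' j1').
rewrite /= !index_shift.
have QT : `[c, d] `*` `[c', d'] `<=` cell h (kappa.1 - i, kappa.2 - j).
  move=> [x y] [/=]; rewrite !in_itv /= => /cdP[? _] /cdP'[? _].
  by rewrite /cell /=; split => /=; rewrite in_itv.
apply => //; [exact: mOmega|move=> z; exact: average_shift_sub|].
move=> [x y] Qxy; have T := QT _ Qxy.
have w := stencil_cell_window i1' j1' T.
have T' : cell h (kappa.1 + i, kappa.2 + j) (lattice_shift h (i - - i, j - - j) (x, y)).
  have := (cell_shift h (kappa.1 - i, kappa.2 - j) (i - - i, j - - j) (x, y)).2 T.
  by rewrite /= !index_shift.
have := stencil_cell_window i1 j1 T'; rewrite /lattice_shift /shift2 /= => w'.
case: Qxy => /=; rewrite !in_itv /= => /cdP[_ xe] /cdP'[_ ye].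
have near p q x' y' : `|x' - x0| + `|y' - y0| < rho ->
    `|x' - x0 - p| <= eps -> `|y' - y0 - q| <= eps ->
    `|G x' y' - (nu1 * p + nu2 * q)| <= eta * (`|p| + `|q|) + delta / 4.
  move=> w2 xp yq; have := Glin w2 w0; rewrite G0 subr0 => l.
  have -> : G x' y' - (nu1 * p + nu2 * q) =
      G x' y' - (nu1 * (x' - x0) + nu2 * (y' - y0))
      + (nu1 * (x' - x0 - p) + nu2 * (y' - y0 - q)) by ring.
  apply: (le_trans (ler_normD _ _)).
  have dE : delta / 4 = K * eps by rewrite /eps; field; rewrite gt_eqF.
  have lx : `|x' - x0| <= `|p| + eps.
    by rewrite -[x' - x0](subrK p) addrC (le_trans (ler_normD _ _)) // lerD2l.
  have ly : `|y' - y0| <= `|q| + eps.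
    by rewrite -[y' - y0](subrK q) addrC (le_trans (ler_normD _ _)) // lerD2l.
  have l2 : `|nu1 * (x' - x0 - p) + nu2 * (y' - y0 - q)| <= (`|nu1| + `|nu2|) * eps.
    by rewrite mulrDl (le_trans (ler_normD _ _)) // !normrM lerD // ler_wpM2l.
  have l3 : eta * (`|x' - x0| + `|y' - y0|) <= eta * (`|p| + `|q| + 2 * eps).
    rewrite ler_wpM2l // (le_trans (lerD lx ly)) // addrACA.
    by rewrite mulr_natl mulr2n.
  apply: (le_trans (lerD (le_trans l l3) l2)); rewrite dE /K.
  by rewrite -subr_ge0 [leRHS](_ : _ = eps) ?(ltW eps0) //; ring.
have deltaE : delta = - (nu1 * (h * i%:~R) + nu2 * (h * j%:~R))
    - eta * (h * `|i%:~R| + h * `|j%:~R|) by rewrite /delta; ring.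
have hn (e : int) : `|h * e%:~R| = h * `|e%:~R| by rewrite normrM gtr0_norm.
split.
  move/(OmegaE w); apply/negP; rewrite -ltNge.
  have := near (- (h * i%:~R)) (- (h * j%:~R)) x y w.
  rewrite !normrN !hn !opprK; have -> : x - x0 + h * i%:~R = x - x1 by rewrite /x1; ring.
  have -> : y - y0 + h * j%:~R = y - y1 by rewrite /y1; ring.
  move=> /(_ xe ye); rewrite ler_norml => /andP[l _].
  by apply: margin_gt0 delta0 deltaE _; move: l; rewrite !mulrN -opprD.
apply/(OmegaE w').
have := near (h * i%:~R) (h * j%:~R) _ _ w'; rewrite !hn di dj.
have -> : x + h * (2 * i%:~R) - x0 - h * i%:~R = x - x1 by rewrite /x1; ring.
have -> : y + h * (2 * j%:~R) - y0 - h * j%:~R = y - y1 by rewrite /y1; ring.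
by move=> /(_ xe ye) /ler_normlW; exact: margin_le0 delta0 deltaE.
Qed.

Let H := sobel_H \1_Omega h kappa.
Let V := sobel_V \1_Omega h kappa.

(** Up to the sign [q], each component of the Sobel gradient is a sum, with
    positive weights, of differences of averages along the axis, over two cells
    exchanged by the translation of two mesh steps. *)
Lemma sobel_axis (q : int) : `|q| = 1 ->
  (nu1 * q%:~R + eta < 0 -> 0 < q%:~R * H) /\
  (nu2 * q%:~R + eta < 0 -> 0 < q%:~R * V).
Proof.
move=> q1; have qR : `|q%:~R| = 1 :> R by rewrite -intr_norm q1.
have qle : `|q| <= 1 by rewrite q1.
have qNle : `|- q| <= 1 by rewrite normrN q1.
have dq : (q - - q)%:~R = 2 * q%:~R :> R by rewrite opprK intrD; ring.
have le0 nu : nu * q%:~R + eta < 0 -> nu * (2 * q%:~R) + eta * (2 * 1) <= 0.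
  move=> n; have -> : nu * (2 * q%:~R) + eta * (2 * 1) = 2 * (nu * q%:~R + eta).
    by ring.
  by rewrite pmulr_rle0 // ltW.
split => n.
  have lt : a (- q) 0 < a q 0.
    have := @average_lt q 0; rewrite oppr0; apply => //.
    by rewrite mulr0z mulr0 addr0 normr0 addr0 qR mulr1.
  have le (i : int) : `|i| <= 1 -> a (- q) i <= a q i.
    move=> i1; apply: average_le => //; rewrite subrr mulr0z mulr0 normr0 !addr0.
    by rewrite dq normrM qR normr_nat; exact: le0.
  move: lt (le 1 isT) (le (-1) isT); rewrite /H /sobel_H -!/(a _ _).
  have [->|->] := norm1_int q1; rewrite ?opprK ?mulr1z ?mulrN1z;
    move: (a _ _) (a _ _) (a _ _) (a _ _) (a _ _) (a _ _) => *; lra.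
have lt : a 0 (- q) < a 0 q.
  have := @average_lt 0 q; rewrite oppr0; apply => //.
  by rewrite mulr0z mulr0 add0r normr0 add0r qR mulr1.
have le (i : int) : `|i| <= 1 -> a i (- q) <= a i q.
  move=> i1; apply: average_le => //; rewrite subrr mulr0z mulr0 normr0 !add0r.
  by rewrite dq normrM qR normr_nat; exact: le0.
move: lt (le 1 isT) (le (-1) isT); rewrite /V /sobel_V -!/(a _ _).
have [->|->] := norm1_int q1; rewrite ?opprK ?mulr1z ?mulrN1z;
  move: (a _ _) (a _ _) (a _ _) (a _ _) (a _ _) (a _ _) => *; lra.
Qed.

(** In [p H + q V] the corners [(p, - q)] and [(- p, q)] cancel and the other
    six cells are paired by the translations [(p, q)] and [2 (p, q)], each with
    weight 2. Comparing [|H|] with [|V|] thus reduces to the monotonicity of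
    the domain along the diagonals. *)
Lemma sobel_diagonal (p q : int) : `|p| = 1 -> `|q| = 1 ->
  nu1 * p%:~R + nu2 * q%:~R + 2 * eta < 0 -> 0 < p%:~R * H + q%:~R * V.
Proof.
move=> p1 q1 n.
have pR : `|p%:~R| = 1 :> R by rewrite -intr_norm p1.
have qR : `|q%:~R| = 1 :> R by rewrite -intr_norm q1.
have ple : `|p| <= 1 by rewrite p1.
have qle : `|q| <= 1 by rewrite q1.
have pNle : `|- p| <= 1 by rewrite normrN p1.
have qNle : `|- q| <= 1 by rewrite normrN q1.
have n' : nu1 * p%:~R + nu2 * q%:~R + eta * (1 + 1) < 0.
  by rewrite [eta * _]mulrC.
have lt : a (- p) (- q) < a p q by apply: average_lt => //; rewrite pR qR.
have le1 : a (- p) 0 <= a 0 q.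
  by apply: average_le => //; rewrite sub0r opprK subr0 pR qR ltW.
have le2 : a 0 (- q) <= a p 0.
  by apply: average_le => //; rewrite sub0r opprK subr0 pR qR ltW.
move: lt le1 le2; rewrite /H /V /sobel_H /sobel_V -!/(a _ _).
have [->|->] := norm1_int p1; have [->|->] := norm1_int q1;
  rewrite ?opprK ?mulr1z ?mulrN1z;
  move: (a _ _) (a _ _) (a _ _) (a _ _) (a _ _) (a _ _) (a _ _) (a _ _) => *; lra.
Qed.

End SobelSigns.

(** * Boundary points and charts *)

Section BoundaryPoints.
Context {R : realType}.

(** Without boundary points in [S], the interior and the closure of [A] have
    the same trace on [S], which is then clopen in [S]. *)
Lemma connected_boundary (T : topologicalType) (S A : set T) :
  connected S -> S `&` A !=set0 -> S `&` ~` A !=set0 ->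
  exists2 z, S z & boundary A z.
Proof.
move=> cS [a [Sa Aa]] [b [Sb nAb]].
apply: contrapT => nobd.
have bd z : S z -> closure A z -> A° z.
  by move=> Sz cz; apply: contrapT => nz; apply: nobd; exists z.
have e : S `&` A° = S.
  apply: cS; first by exists a; split => //; apply: bd => //; exact: subset_closure.
    by exists A° => //; exact: open_interior.
  exists (closure A); first exact: closed_closure.
  apply/seteqP; split => z [Sz]; last by move=> cz; split => //; exact: bd.
  by move=> /interior_subset Az; split => //; exact: subset_closure.
by move: Sb; rewrite -e => -[_ /interior_subset].
Qed.

Lemma affine_path_continuous (c d : R) : continuous (fun t : R => c + d * t).
Proof.
by move=> t; apply: cvgD; [exact: cvg_cst|apply: cvgM; [exact: cvg_cst|exact: cvg_id]].
Qed.

Lemma segment_boundary (A : set (R * R)) (z w : R * R) : A z -> ~ A w ->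
  exists t : R, t \in `[0, 1] /\
    boundary A (z.1 + (w.1 - z.1) * t, z.2 + (w.2 - z.2) * t).
Proof.
move=> Az nAw; pose f (t : R) := (z.1 + (w.1 - z.1) * t, z.2 + (w.2 - z.2) * t).
have cf : connected (f @` `[0, 1]).
  apply: connected_continuous_connected; first exact: segment_connected.
  apply: continuous_subspaceT => t.
  apply: (@cvg_pair _ _ _ (nbhs t) (nbhs (f t).1) (nbhs (f t).2)); exact: affine_path_continuous.
have f0 : f 0 = z by rewrite /f !mulr0 !addr0; case: (z).
have f1 : f 1 = w by rewrite /f !mulr1 !subrKC; case: (w).
have [| |y [t t01 <-] bt] := connected_boundary cf (A := A).
- by exists z; split => //; exists 0 => //=; rewrite in_itv /= lexx ler01.
- by exists w; split => //; exists 1 => //=; rewrite in_itv /= lexx ler01.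
- by exists t.
Qed.

Lemma convex_between (lo hi x y t : R) : t \in `[0, 1] ->
  lo <= x <= hi -> lo <= y <= hi -> lo <= x + (y - x) * t <= hi.
Proof.
rewrite in_itv /= => /andP[t0 t1] /andP[lx xh] /andP[ly yh].
have -> : x + (y - x) * t = (1 - t) * x + t * y by ring.
have t1' : 0 <= 1 - t by rewrite subr_ge0.
apply/andP; split.
  have -> : lo = (1 - t) * lo + t * lo by ring.
  by apply: lerD; rewrite ler_wpM2l.
have -> : hi = (1 - t) * hi + t * hi by ring.
by apply: lerD; rewrite ler_wpM2l.
Qed.

Lemma singular_cell_boundary (Omega : set (R * R)) (h : R) (kappa : int * int) :
  singular_cell Omega (cell h kappa) ->
  exists2 z, cell h kappa z & boundary Omega z.
Proof.
have ne (A : set (measurableTypeR R * measurableTypeR R)) :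
    lebesgue2 R A != 0%E -> A !=set0.
  by move=> nz; apply/set0P; apply: contra nz => /eqP ->; rewrite measure0.
move=> [/ne[z [Tz Oz]] /ne[w [Tw Ow]]].
have [t [t01 bt]] := segment_boundary Oz Ow.
exists (z.1 + (w.1 - z.1) * t, z.2 + (w.2 - z.2) * t) => //.
move: Tz Tw; rewrite /cell /= !in_itv /= => -[z1 z2] [w1 w2].
by split; exact: convex_between.
Qed.
End BoundaryPoints.

(** The radius is chosen before [psi], hence is the same for all charts. The
    derivative is Hölder of exponent [s - 1] when it is the top one, and
    Lipschitz otherwise. *)
Lemma holder_derivative_modulus {R : realType} (s r M eta : R) :
  1 < s -> 0 < r -> 0 < M -> 0 < eta ->
  exists rho, [/\ 0 < rho, rho <= r & forall psi : R -> R,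
    holder_class s (- r) r psi -> (holder_norm s (- r) r psi <= M%:E)%E ->
    forall t, t \in `](- rho), rho[ ->
      `|derive1n 1 psi t - derive1n 1 psi 0| <= eta].
Proof.
move=> s1 r0 M0 eta0; have [m0 al0 al1] := holder_order_exponent s1.
set al := s - _ in al0 al1.
have q0 : 0 < eta / M by rewrite divr_gt0.
pose rho := Num.min r (Num.min (eta / M) ((eta / M) `^ al^-1)).
have rho0 : 0 < rho by rewrite !lt_min r0 q0 powR_gt0.
have rhor : rho <= r by rewrite ge_min lexx.
exists rho; split => // psi [_ dpsi _] npsi t trho.
have rr : - r < r by rewrite gt0_cp.
have [bd md] := holder_norm_le rr npsi.
have sub : `](- rho), rho[ `<=` `](- r), r[.
  move=> x /=; rewrite !in_itv /= => /andP[? ?]; apply/andP; split.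
    by apply: le_lt_trans (_ : - rho < _); rewrite ?lerN2.
  exact: lt_le_trans rhor.
have tr : t \in `](- r), r[ by exact: sub.
have z_rho : 0 \in `](- rho), rho[ by rewrite in_itv /= oppr_lt0 rho0.
have zr : 0 \in `](- r), r[ by exact: sub.
have ta : `|t| <= rho by move: trho; rewrite in_itv /= -ltr_norml => /ltW.
have [m1|m1] := leqP (holder_order s) 1.
  have e : holder_order s = 1%N by apply/eqP; rewrite eqn_leq m1 m0.
  have := md t 0 tr zr; rewrite -/al e subr0 => /le_trans; apply.
  have -> : eta = M * ((eta / M) `^ al^-1) `^ al.
    by rewrite -powRrM mulVf ?gt_eqF // powRr1 ?(ltW q0) // mulrCA divff ?mulr1 ?gt_eqF.
  rewrite ler_wpM2l ?(ltW M0) //; apply: ge0_ler_powR; rewrite ?nnegrE ?powR_ge0 ?(ltW al0) //.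
  by apply: (le_trans ta); rewrite !ge_min lexx !orbT.
have d2 x : x \in `](- r), r[ -> is_derive x 1 (derive1n 1 psi) (derive1n 2 psi x).
  by move=> xr; rewrite [derive1n 2 psi]derive1nS derive1E; apply/derivableP; exact: dpsi.
have d2b x : x \in `](- r), r[ -> `|derive1n 2 psi x - 0| <= M.
  by move=> xr; rewrite subr0; exact: bd.
have := derive_near_affine d2 d2b tr zr; rewrite mul0r !subr0 => /le_trans; apply.
have -> : eta = M * (eta / M) by rewrite mulrCA divff ?mulr1 ?gt_eqF.
rewrite ler_wpM2l ?(ltW M0) //; apply: (le_trans ta).
by rewrite !ge_min lexx !orbT.
Qed.

(** A description of [O] by a curve of nearly constant slope, at distance less
    than [rho] from [(x0, y0)], in the frame [(e11, e12)], [(e21, e22)]. Curried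
    membership and scalar coordinates make exchanging the two axes immediate,
    so that graphs over either axis are treated at once. *)
Record flat_chart {R : realType} (s : R) (O : R -> R -> Prop) (eta rho x0 y0 : R)
    (e11 e12 e21 e22 : R) (psi : R -> R) (p : R) : Prop := FlatChart {
  chart_unit1 : e11 * e11 + e12 * e12 = 1;
  chart_unit2 : e21 * e21 + e22 * e22 = 1;
  chart_orthogonal : e11 * e21 + e12 * e22 = 0;
  chart_rho_gt0 : 0 < rho;
  chart_base : psi 0 = 0;
  chart_derive : forall t : R, t \in `](- rho), rho[ ->
    is_derive t 1 psi (derive1n 1 psi t);
  chart_slope : forall t : R, t \in `](- rho), rho[ ->
    `|derive1n 1 psi t - p| <= eta;
  chart_hol : hol (s - (holder_order s)%:R) (- rho) rho (holder_order s) psi;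
  chart_hol_derive :
    hol (s - (holder_order s)%:R) (- rho) rho (holder_order s).-1 (derive1n 1 psi);
  chart_level : forall x y, `|x - x0| + `|y - y0| < rho ->
    O x y <-> level psi e11 e12 e21 e22 x0 y0 x y <= 0 }.

Section Charts.
Context {R : realType}.
Implicit Types (s eta rho : R).

Lemma flat_chart_swap s O eta rho x0 y0 e11 e12 e21 e22 psi (p : R) :
  flat_chart s O eta rho x0 y0 e11 e12 e21 e22 psi p ->
  flat_chart s (fun x y => O y x) eta rho y0 x0 e12 e11 e22 e21 psi p.
Proof.
case=> n1 n2 o rho0 b d sl h h' lv; split => //; try by rewrite addrC.
move=> x y; rewrite addrC => /lv ->; rewrite /level /normal_coord /tangent_coord.
by rewrite [e21 * _ + _]addrC [e11 * _ + _]addrC.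
Qed.

(** At a boundary point the level function vanishes: it is continuous, and its
    strict signs would put the point in the interior or in the exterior. *)
Lemma boundary_level_eq0 (Omega : set (R * R)) (G : R -> R -> R) (x0 y0 rho K : R) :
  0 < rho -> 0 < K -> boundary Omega (x0, y0) ->
  (forall x y, `|x - x0| + `|y - y0| < rho ->
    Omega (x, y) <-> G x y <= 0) ->
  (forall x y, `|x - x0| + `|y - y0| < rho ->
    `|G x y - G x0 y0| <= K * (`|x - x0| + `|y - y0|)) ->
  G x0 y0 = 0.
Proof.
move=> rho0 K0 [cl nint] OE GL; apply/eqP; rewrite eq_le; apply/andP; split.
  rewrite leNgt; apply/negP => g0.
  pose e := Num.min (rho / 2) (G x0 y0 / (4 * K)).
  have e0 : 0 < e by rewrite lt_min !divr_gt0 // mulr_gt0.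
  have er : e <= rho / 2 by rewrite ge_min lexx.
  have eK : 4 * K * e <= G x0 y0.
    by rewrite mulrC -ler_pdivlMr ?mulr_gt0 // ge_min lexx orbT.
  have nb : nbhs (x0, y0) [set z : R * R | ~ Omega z].
    apply/nbhs_ballP; exists e => //= -[x y] [/= hx hy].
    rewrite /ball /= distrC in hx; rewrite /ball /= distrC in hy.
    have w : `|x - x0| + `|y - y0| < rho by lra.
    move/(OE _ _ w) => g; have := GL _ _ w; rewrite ler_norml => /andP[l _].
    have : K * (`|x - x0| + `|y - y0|) <= K * (2 * e).
      by rewrite ler_pM2l //; lra.
    by move=> ?; nra.
  by have [z []] := cl _ nb.
rewrite leNgt; apply/negP => g0; apply: nint.
pose e := Num.min (rho / 2) (- G x0 y0 / (4 * K)).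
have e0 : 0 < e by rewrite lt_min !divr_gt0 ?oppr_gt0 // mulr_gt0.
have er : e <= rho / 2 by rewrite ge_min lexx.
have eK : 4 * K * e <= - G x0 y0.
  by rewrite mulrC -ler_pdivlMr ?mulr_gt0 // ge_min lexx orbT.
apply/nbhs_ballP; exists e => //= -[x y] [/= hx hy].
rewrite /ball /= distrC in hx; rewrite /ball /= distrC in hy.
have w : `|x - x0| + `|y - y0| < rho by lra.
apply/(OE _ _ w); have := GL _ _ w; rewrite ler_norml => /andP[_ l].
have : K * (`|x - x0| + `|y - y0|) <= K * (2 * e).
  by rewrite ler_pM2l //; lra.
by move=> ?; nra.
Qed.

(** Choosing [rho] before the boundary point is what lets the mesh threshold
    depend on the domain only. *)
Lemma boundary_flat_chart s (Omega : set (R * R)) eta :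
  1 < s -> Cs_domain s Omega -> 0 < eta ->
  exists2 rho, 0 < rho & forall x0 y0, boundary Omega (x0, y0) ->
    exists e11 e12 e21 e22 psi p,
      flat_chart s (fun x y => Omega (x, y)) eta rho x0 y0 e11 e12 e21 e22 psi p.
Proof.
move=> s1 [r [P [M [r0 P1 M0 charts]]]] eta0.
have [rho [rho0 rhor modulus]] := holder_derivative_modulus s1 r0 M0 eta0.
exists rho => // x0 y0 bz.
have [[e11 e12] [[e21 e22] [psi [[/= n1 n2 o] [psiC psiM] _ psiE]]]] := charts _ bz.
rewrite /dot2 /= in n1 n2 o.
have [m0 _ _] := holder_order_exponent s1.
have rr : - r < r by rewrite gt0_cp.
have sub : `](- rho), rho[ `<=` `](- r), r[.
  move=> x /=; rewrite !in_itv /= => /andP[? ?]; apply/andP; split.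
    by apply: le_lt_trans (_ : - rho < _); rewrite ?lerN2.
  exact: lt_le_trans rhor.
have psiD t : t \in `](- rho), rho[ -> is_derive t 1 psi (derive1n 1 psi t).
  move=> /sub tr; rewrite derive1n1 derive1E; apply/derivableP.
  by case: psiC => _ d _; have := d 0%N t m0 tr.
pose p := derive1n 1 psi 0.
have slope t : t \in `](- rho), rho[ -> `|derive1n 1 psi t - p| <= eta.
  exact: modulus.
have [c1 c2 c12 _] := frame_columns p n1 n2 o.
have lv x y : `|x - x0| + `|y - y0| < rho ->
    Omega (x, y) <-> level psi e11 e12 e21 e22 x0 y0 x y <= 0.
  move=> w; set t := tangent_coord e11 e12 x0 y0 x y.
  set n := normal_coord e21 e22 x0 y0 x y.
  have -> : (x, y) = (x0, y0) + t *: (e11, e12) + n *: (e21, e22).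
    have ex : x = x0 + t * e11 + n * e21.
      transitivity (x0 + (e11 * e11 + e21 * e21) * (x - x0)
        + (e11 * e12 + e21 * e22) * (y - y0)); first by rewrite c1 c12; ring.
      by rewrite /t /n /tangent_coord /normal_coord; ring.
    have ey : y = y0 + t * e12 + n * e22.
      transitivity (y0 + (e12 * e12 + e22 * e22) * (y - y0)
        + (e11 * e12 + e21 * e22) * (x - x0)); first by rewrite c2 c12; ring.
      by rewrite /t /n /tangent_coord /normal_coord; ring.
    by rewrite {1}ex {1}ey.
  rewrite psiE /level ?subr_le0 //.
    have := tangent_coord_window n1 w; rewrite in_itv /= -ltr_norml => /ltW.
    by move=> /le_trans; apply.
  have := tangent_coord_window n2 w; rewrite in_itv /= -ltr_norml => /ltW.
  move=> /le_trans; apply; apply: (le_trans rhor).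
  by rewrite ler_peMl // ltW.
have base : psi 0 = 0.
  have G0 : level psi e11 e12 e21 e22 x0 y0 x0 y0 = - psi 0.
    by rewrite /level /normal_coord /tangent_coord !subrr !mulr0 addr0 sub0r.
  apply/eqP; rewrite -oppr_eq0 -G0; apply/eqP.
  apply: (@boundary_level_eq0 Omega _ x0 y0 rho
    (`|nu1 p e11 e21| + `|nu2 p e12 e22| + eta)) => //.
    by rewrite ltr_wpDl // addr_ge0.
  move=> x y w.
  have w0 : `|x0 - x0| + `|y0 - y0| < rho by rewrite !subrr normr0 addr0.
  have := level_near_linear e21 e22 n1 rho0 psiD slope w w0.
  set N1 := nu1 _ _ _; set N2 := nu2 _ _ _; set g := level _ _ _ _ _ _ _ _ _ - _ => l.
  rewrite -[g](subrK (N1 * (x - x0) + N2 * (y - y0))).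
  apply: (le_trans (ler_normD _ _)); apply: (le_trans (lerD l (ler_normD _ _))).
  rewrite !normrM.
  have a1 : 0 <= `|N1| * `|y - y0| by rewrite mulr_ge0.
  have a2 : 0 <= `|N2| * `|x - x0| by rewrite mulr_ge0.
  by move: (`|x - x0|) (`|y - y0|) (`|N1|) (`|N2|) a1 a2 => ? ? ? ? ? ?; lra.
exists e11, e12, e21, e22, psi, p; split => //.
- apply: (hol_subset sub); have := holder_class_hol rr psiC psiM (leq0n _).
  by rewrite subn0.
- apply: (hol_subset sub); have := holder_class_hol rr psiC psiM m0.
  by rewrite subn1.
Qed.
End Charts.

(** * From the Sobel gradient to a graph over the stencil *)

Section FlatCharts.
Context {R : realType}.
Implicit Types (s eta rho h x y p : R).

Lemma chart_measurable s (Omega : set (R * R)) eta rho x0 y0 e11 e12 e21 e22 psi p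
    (T : set (measurableTypeR R * measurableTypeR R)) :
  flat_chart s (fun x y => Omega (x, y)) eta rho x0 y0 e11 e12 e21 e22 psi p ->
  measurable T ->
  (forall x y, T (x, y) -> `|x - x0| + `|y - y0| < rho) ->
  measurable (Omega `&` T : set (measurableTypeR R * measurableTypeR R)).
Proof.
case=> n1 n2 o rho0 b d sl hh hh' lv mT win.
pose D : set R := [set` `](- rho), rho[].
have mD : measurable (D : set (measurableTypeR R)) by exact: measurable_itv.
have mpsi : measurable_fun D (psi : measurableTypeR R -> measurableTypeR R).
  apply: open_continuous_measurable_fun; first exact: interval_open.
  move=> t; rewrite inE => /d dt.
  by apply: differentiable_continuous; apply/derivable1_diffP; exact: ex_derive.
have mpsiD : measurable_fun setT ((psi \_ D) : measurableTypeR R -> measurableTypeR R).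
  apply/(measurable_restrict psi mD) => //; rewrite setTI; exact: mpsi.
have mcoord (a1 a2 : R) : measurable_fun setT
    (fun z : measurableTypeR R * measurableTypeR R =>
      a1 * (z.1 - x0) + a2 * (z.2 - y0)).
  apply: measurable_funD; apply: measurable_funM; try exact: measurable_cst.
    by apply: measurable_funB; [exact: measurable_fst|exact: measurable_cst].
  by apply: measurable_funB; [exact: measurable_snd|exact: measurable_cst].
have -> : Omega `&` T = T `&` [set z | normal_coord e21 e22 x0 y0 z.1 z.2 <=
    (psi \_ D) (tangent_coord e11 e12 x0 y0 z.1 z.2)].
  have tE x y : T (x, y) -> (psi \_ D) (tangent_coord e11 e12 x0 y0 x y) =
      psi (tangent_coord e11 e12 x0 y0 x y).
    by move=> /win w; rewrite patchE mem_set //; exact: tangent_coord_window.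
  apply/seteqP; split => -[x y] /= [].
    by move=> Oxy Txy; split => //; rewrite tE // -subr_le0; apply/(lv _ _ (win _ _ Txy)).
  by move=> Txy; rewrite tE // -subr_le0 => /(lv _ _ (win _ _ Txy)).
apply: measurable_fun_le => //.
  by apply: (measurable_funS measurableT) => //; exact: mcoord.
apply: (measurable_funS measurableT) => //.
exact: (measurableT_comp mpsiD (mcoord e11 e12)).
Qed.

(** The Sobel gradient points, like minus the normal, from the complement to
    the domain: each component has the sign opposite to that of the normal as
    soon as the latter exceeds [eta], and the larger component of the gradient
    is, up to [2 eta], the larger component of the normal. *)
Lemma chart_sobel s (Omega : set (R * R)) eta rho x0 y0 e11 e12 e21 e22 psi p h
    (kappa : int * int) :
  flat_chart s (fun x y => Omega (x, y)) eta rho x0 y0 e11 e12 e21 e22 psi p ->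
  0 < h -> 4 * h < rho -> cell h kappa (x0, y0) ->
  let H := sobel_H \1_Omega h kappa in let V := sobel_V \1_Omega h kappa in
  let n1 := nu1 p e11 e21 in let n2 := nu2 p e12 e22 in
  [/\ `|H| <= `|V| -> `|n1| <= `|n2| + 2 * eta,
      `|V| < `|H| -> `|n2| <= `|n1| + 2 * eta,
      (eta < n1 -> H < 0) /\ (n1 < - eta -> 0 < H)
    & (eta < n2 -> V < 0) /\ (n2 < - eta -> 0 < V)].
Proof.
move=> ch h0 hr zT H V n1 n2.
have [u1 u2 o rho0 b d sl _ _ lv] := ch.
have eta0 := eta_ge0 rho0 sl.
have lin := level_near_linear e21 e22 u1 rho0 d sl (x0 := x0) (y0 := y0).
have g0 := level0 e11 e12 e21 e22 x0 y0 b.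
have mO (i j : int) : `|i| <= 1 -> `|j| <= 1 ->
    measurable (Omega `&` cell h (kappa.1 + i, kappa.2 + j) :
      set (measurableTypeR R * measurableTypeR R)).
  move=> i1 j1; apply: (chart_measurable ch); first exact: measurable_cell.
  by move=> x y; apply: (stencil_cell_window h0 hr zT).
have axis (q : int) := sobel_axis h0 eta0 hr zT lv g0 lin mO (q := q).
have diag (a c : int) := sobel_diagonal h0 eta0 hr zT lv g0 lin mO (p := a) (q := c).
have [axH axV] := axis 1 (normr1 _); have [axH' axV'] := axis (-1) (normrN1 _).
have d11 := diag 1 1 (normr1 _) (normr1 _).
have d1N := diag 1 (-1) (normr1 _) (normrN1 _).
have dN1 := diag (-1) 1 (normrN1 _) (normr1 _).
have dNN := diag (-1) (-1) (normrN1 _) (normrN1 _).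
rewrite -/H -/V -/n1 -/n2 ?mulr1z ?mulrN1z in axH axV axH' axV' d11 d1N dN1 dNN.
(* What remains is linear arithmetic on the facts just collected. *)
move: (H) (V) (n1) (n2) axH axV axH' axV' d11 d1N dN1 dNN eta0.
move: eta {ch sl lin axis diag} => {H V n1 n2}.
clear; move=> e H V n1 n2 axH axV axH' axV' d11 d1N dN1 dNN e0; split.
- move=> HV; rewrite leNgt; apply/negP => n12; move: HV; apply/negP; rewrite -ltNge.
  have [n10|n10] := leP 0 n1.
    rewrite (ger0_norm n10) in n12.
    have := ler_norm n2; have := ler_norm (- n2); rewrite normrN => ? ?.
    have ? : 0 < -1 * H + 1 * V by apply: dN1; lra.
    have ? : 0 < -1 * H + -1 * V by apply: dNN; lra.
    apply: (@lt_le_trans _ _ (- H)); last by rewrite -normrN ler_norm.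
    by rewrite ltr_norml; apply/andP; split; lra.
  rewrite (ltr0_norm n10) in n12.
  have := ler_norm n2; have := ler_norm (- n2); rewrite normrN => ? ?.
  have ? : 0 < 1 * H + 1 * V by apply: d11; lra.
  have ? : 0 < 1 * H + -1 * V by apply: d1N; lra.
  apply: (@lt_le_trans _ _ H); last by rewrite ler_norm.
  by rewrite ltr_norml; apply/andP; split; lra.
- move=> /ltW HV; rewrite leNgt; apply/negP => n12; move: HV; apply/negP; rewrite -ltNge.
  have [n20|n20] := leP 0 n2.
    rewrite (ger0_norm n20) in n12.
    have := ler_norm n1; have := ler_norm (- n1); rewrite normrN => ? ?.
    have ? : 0 < 1 * H + -1 * V by apply: d1N; lra.
    have ? : 0 < -1 * H + -1 * V by apply: dNN; lra.
    apply: (@lt_le_trans _ _ (- V)); last by rewrite -normrN ler_norm.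
    by rewrite ltr_norml; apply/andP; split; lra.
  rewrite (ltr0_norm n20) in n12.
  have := ler_norm n1; have := ler_norm (- n1); rewrite normrN => ? ?.
  have ? : 0 < 1 * H + 1 * V by apply: d11; lra.
  have ? : 0 < -1 * H + 1 * V by apply: dN1; lra.
  apply: (@lt_le_trans _ _ V); last by rewrite ler_norm.
  by rewrite ltr_norml; apply/andP; split; lra.
- split=> n; first by rewrite -oppr_gt0 -mulN1r; apply: axH'; lra.
  by rewrite -[H]mul1r; apply: axH; lra.
- split=> n; first by rewrite -oppr_gt0 -mulN1r; apply: axV'; lra.
  by rewrite -[V]mul1r; apply: axV; lra.
Qed.

Lemma stencil_sideE h (i : int) (k : nat) (x : R) :
  (x \in stencil_side h i k) =
  (h * i%:~R - h * k%:R <= x <= h * i%:~R + h * k%:R + h).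
Proof.
rewrite /stencil_side /stencil_lo /stencil_hi in_itv /=.
by rewrite !intrD !intrN !mulrDr mulrN mulr1.
Qed.

Lemma stencil_side_dist h (i : int) (k : nat) (x0 x : R) :
  h * i%:~R <= x0 <= h * i%:~R + h -> x \in stencil_side h i k ->
  `|x - x0| <= (k%:R + 1) * h.
Proof.
move=> /andP[? ?]; rewrite stencil_sideE => /andP[? ?].
by rewrite ler_norml; apply/andP; split; lra.
Qed.

Lemma dist_stencil_side h (i : int) (k : nat) (x0 x : R) :
  h * i%:~R <= x0 <= h * i%:~R + h -> `|x - x0| <= k%:R * h ->
  x \in stencil_side h i k.
Proof.
move=> /andP[? ?]; rewrite stencil_sideE ler_norml => /andP[? ?].
by apply/andP; split; lra.
Qed.

Lemma stencil_side_interior h (i : int) (k : nat) (x0 : R) :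
  0 < h -> h * i%:~R <= x0 <= h * i%:~R + h ->
  [/\ x0 - (k%:R + 2) * h < stencil_lo h i k,
      stencil_lo h i k < stencil_hi h i k &
      stencil_hi h i k < x0 + (k%:R + 2) * h].
Proof.
move=> h0 /andP[? ?]; rewrite /stencil_lo /stencil_hi ltr_pM2l // ltr_int.
rewrite !intrD !intrN !mulrDr -!pmulrn mulr1; split; first by lra.
  by lia.
by lra.
Qed.

(** From [b >= 1 / 2 - eta] and [a <= b + 2 eta], the slope [a / b] exceeds 1 by
    less than [q], with room for the errors of order [eta]. *)
Lemma slope_margin (q eta a b : R) : 0 < q -> q <= 1 -> eta = q / 32 ->
  1 <= a + b -> a <= b + 2 * eta ->
  eta < b /\ a + eta + (1 + q) * eta < (1 + q) * b.
Proof.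
move=> q0 q1 -> ab ba.
have b1 : 15 / 32 <= b by lra.
have qb : q * (15 / 32) <= q * b by rewrite ler_pM2l.
have qq : q * q <= q by rewrite ler_piMl // ltW.
by split; lra.
Qed.

(** The normal is at least as steep as a diagonal up to [2 eta], so the slope of
    the curve is at most [1 + 1 / (k + 1)]. The abscissas of the stencil are
    within [(k + 1) h] of [x0], hence its graph within [(k + 2) h] of [y0]: this
    is why the stencil extends [k + 2] cells on both sides of that of [y0]. *)
Lemma stencil_graph s (O : R -> R -> Prop) eta rho x0 y0 e11 e12 e21 e22 psi p h
    (i j : int) (k : nat) :
  1 < s ->
  flat_chart s O eta rho x0 y0 e11 e12 e21 e22 psi p ->
  0 < h -> h * i%:~R <= x0 <= h * i%:~R + h -> h * j%:~R <= y0 <= h * j%:~R + h ->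
  eta = (32 * k.+1%:R)^-1 -> 4 * (k%:R + 4) * h < rho ->
  let n1 := nu1 p e11 e21 in let n2 := nu2 p e12 e22 in
  `|n1| <= `|n2| + 2 * eta ->
  eta < `|n2| /\ exists phi : R -> R,
  [/\ holder_class s (stencil_lo h i k) (stencil_hi h i k) phi,
      forall x, x \in stencil_side h i k -> phi x \in stencil_side h j (k + 2),
      eta < n2 -> forall x y, x \in stencil_side h i k ->
        y \in stencil_side h j (k + 2) -> O x y <-> y <= phi x
    & n2 < - eta -> forall x y, x \in stencil_side h i k ->
        y \in stencil_side h j (k + 2) -> O x y <-> y >= phi x].
Proof.
move=> s1 [u1 u2 o rho0 b d sl ho ho' lv] h0 x0T y0T etaE hr n1 n2 nn.
have [m0 al0 al1] := holder_order_exponent s1.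
pose q : R := k.+1%:R^-1.
have qk : q * (k%:R + 1) = 1 by rewrite natr1 mulVf // pnatr_eq0.
have q0 : 0 < q by rewrite invr_gt0 ltr0n.
have q1 : q <= 1 by rewrite invf_le1 ?ltr0n // ler1n.
have eq : eta = q / 32 by rewrite etaE invfM mulrC.
have [nb flat] := slope_margin q0 q1 eq (normal_large p u1 u2 o) nn.
have le_rho (c : R) : c <= 4 * (k%:R + 4) -> c * h <= rho.
  by move=> ch; apply: ltW; apply: le_lt_trans hr; rewrite ler_pM2r.
have k0 : 0 <= k%:R :> R by exact: ler0n.
have window : (1 + (1 + q)) * ((k%:R + 2) * h) <= rho.
  rewrite mulrA le_rho // mulrDr; move: (k%:R) q q1 k0 {qk eq flat q0} => c e.
  clear; move=> ? ?; nra.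
have m0' : 0 < 1 + q by rewrite addr_gt0.
have ho1 : hol (s - (holder_order s)%:R) (- rho) rho (holder_order s).-1.+1 psi.
  by rewrite prednK.
have [phi [phiE phiH]] := level_zero_graph x0 y0 u1 u2 o rho0 b d sl m0' flat
  window al0 al1 ho1 ho'.
rewrite prednK // in phiH.
split=> //.
have lt12 : (k%:R + 1) * h < (k%:R + 2) * h.
  by rewrite ltr_pM2r // ltrD2l ltr1n.
have xI x : x \in stencil_side h i k -> `|x - x0| <= (k%:R + 1) * h.
  exact: stencil_side_dist.
have phiJ x : `|x - x0| <= (k%:R + 1) * h -> `|phi x - y0| <= (k + 2)%:R * h.
  move=> xx; have [l _] := phiE x (le_lt_trans xx lt12); apply: (le_trans l).
  rewrite natrD; have -> : (k%:R + 2) * h = (1 + q) * ((k%:R + 1) * h).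
    by transitivity ((k%:R + 1 + q * (k%:R + 1)) * h); [rewrite qk; ring|ring].
  by rewrite ler_pM2l.
have win x y : `|x - x0| <= (k%:R + 1) * h -> `|y - y0| <= ((k + 2)%:R + 1) * h ->
    `|x - x0| + `|y - y0| < rho.
  move=> xx yy; apply: le_lt_trans (lerD xx yy) _; apply: le_lt_trans hr.
  rewrite -mulrDl ler_pM2r // natrD; move: (k%:R) k0 => c; clear; move=> ?; lra.
have graph x y : x \in stencil_side h i k -> y \in stencil_side h j (k + 2) ->
    [/\ `|x - x0| + `|y - y0| < rho, `|x - x0| + `|phi x - y0| < rho &
        level psi e11 e12 e21 e22 x0 y0 x (phi x) = 0].
  move=> /xI xx /(stencil_side_dist y0T) yy; split; first exact: win.
    by apply: win => //; apply: le_trans (phiJ x xx) _; rewrite ler_pM2r // lerDl.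
  by case: (phiE x (le_lt_trans xx lt12)).
exists phi; split.
- by have [? ? ?] := stencil_side_interior k h0 x0T; apply: (hol_holder_class s1 _ _ _ phiH).
- by move=> x /xI /phiJ; exact: dist_stencil_side.
- move=> nu x y xI' yJ; have [w w' l] := graph x y xI' yJ.
  by rewrite (lv _ _ w); exact: (level_le0_above u1 rho0 d sl nu w w' l).
- move=> nu x y xI' yJ; have [w w' l] := graph x y xI' yJ.
  by rewrite (lv _ _ w); exact: (level_le0_below u1 rho0 d sl nu w w' l).
Qed.
End FlatCharts.

Theorem theorem4p1 (R : realType) (k : nat) (k_ge1 : (1 <= k)%N)
    (s : R) (s_gt1 : 1 < s) (Omega : set (R * R))
    (OmegaD : Omega `<=` unit_square R) (OmegaCs : Cs_domain s Omega) :
  exists2 hstar : R, 0 < hstar &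
  forall (N0 : nat) (h : R), (1 < N0)%N -> h = N0%:R^-1 -> h < hstar ->
  forall (kappa1 kappa2 : 'I_N0),
  let kappa : int * int := (kappa1%:Z, kappa2%:Z) in
  singular_cell Omega (cell h kappa) ->
  let u : R * R -> R := \1_Omega in
  let H := sobel_H u h kappa in
  let V := sobel_V u h kappa in
  let l := (k + 2)%N in
  (* cases 1 and 2: stencil of size (2k+1) x (2l+1), support I x J *)
  (let I := stencil_side h kappa.1 k in
   let J := stencil_side h kappa.2 l in
   (`|V| >= `|H| -> V <= 0 ->
    exists psi : R -> R,
      [/\ holder_class s (stencil_lo h kappa.1 k)
            (stencil_hi h kappa.1 k) psi,
          forall x y : R, x \in I -> y \in J -> (Omega (x, y) <-> y <= psi x)
        & forall x : R, x \in I -> psi x \in J]) /\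
   (`|V| >= `|H| -> V > 0 ->
    exists psi : R -> R,
      [/\ holder_class s (stencil_lo h kappa.1 k)
            (stencil_hi h kappa.1 k) psi,
          forall x y : R, x \in I -> y \in J -> (Omega (x, y) <-> y >= psi x)
        & forall x : R, x \in I -> psi x \in J])) /\
  (* cases 3 and 4: stencil of size (2l+1) x (2k+1), support I x J *)
  (let I := stencil_side h kappa.1 l in
   let J := stencil_side h kappa.2 k in
   (`|V| < `|H| -> H <= 0 ->
    exists psi : R -> R,
      [/\ holder_class s (stencil_lo h kappa.2 k)
            (stencil_hi h kappa.2 k) psi,
          forall x y : R, x \in I -> y \in J -> (Omega (x, y) <-> x <= psi y)
        & forall y : R, y \in J -> psi y \in I]) /\
   (`|V| < `|H| -> H > 0 ->
    exists psi : R -> R,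
      [/\ holder_class s (stencil_lo h kappa.2 k)
            (stencil_hi h kappa.2 k) psi,
          forall x y : R, x \in I -> y \in J -> (Omega (x, y) <-> x >= psi y)
        & forall y : R, y \in J -> psi y \in I])).
Proof.
(* The slope bound [1 + 1 / (k + 1)] of the stencil leaves, above the slope 1 of
   the diagonal, a margin of order [1 / (k + 1)] to absorb the errors. *)
pose eta : R := (32 * k.+1%:R)^-1.
have eta0 : 0 < eta by rewrite invr_gt0 mulr_gt0 // ltr0n.
have [rho rho0 charts] := boundary_flat_chart s_gt1 OmegaCs eta0.
have K0 : 0 < 4 * (k%:R + 4) :> R by rewrite mulr_gt0 // ltr_wpDl // ler0n.
exists (rho / (4 * (k%:R + 4))); first by rewrite divr_gt0.
move=> N0 h N1 hE; rewrite ltr_pdivlMr // mulrC => hsmall kappa1 kappa2 kappa.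
have h0 : 0 < h by rewrite hE invr_gt0 ltr0n (ltn_trans _ N1).
move=> /singular_cell_boundary[[x0 y0] zT bz].
have [e11 [e12 [e21 [e22 [psi [p ch]]]]]] := charts _ _ bz.
have h4 : 4 * h < rho.
  apply: le_lt_trans hsmall; rewrite ler_pM2r // ler_peMr // ler_wpDl ?ler0n //.
  by rewrite ler1n.
move=> u H V l.
have [dV dH [H1 H2] [V1 V2]] := chart_sobel ch h0 h4 zT.
rewrite -/u -/H -/V in dV dH H1 H2 V1 V2.
have [x0T y0T] : h * kappa.1%:~R <= x0 <= h * kappa.1%:~R + h /\
    h * kappa.2%:~R <= y0 <= h * kappa.2%:~R + h.
  by move: zT; rewrite /cell /= !in_itv /= !intrD !mulrDr mulr1 => -[].
have sign (n S : R) : (eta < n -> S < 0) -> (n < - eta -> 0 < S) ->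
    eta < `|n| -> (S <= 0 -> eta < n) /\ (0 < S -> n < - eta).
  move=> pos neg; rewrite ltr_normr ltrNr => /orP[nE|nE]; split=> // sS.
  - by have := lt_trans sS (pos nE); rewrite ltxx.
  - by have := lt_le_trans (neg nE) sS; rewrite ltxx.
split=> I J.
  have graph := stencil_graph s_gt1 ch h0 x0T y0T (erefl _) hsmall.
  split=> HV sV; have [nb [phi [phiC phiJ up down]]] := graph (dV HV);
    have [s1 s2] := sign _ _ V1 V2 nb; exists phi; split => //.
  - exact: up (s1 sV).
  - exact: down (s2 sV).
(* The last two cases are the first two with the axes exchanged. *)
have ch' := flat_chart_swap ch.
have graph := stencil_graph s_gt1 ch' h0 y0T x0T (erefl _) hsmall.
split=> HV sV; have [nb [phi [phiC phiJ up down]]] := graph (dH HV);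
  have [s1 s2] := sign _ _ H1 H2 nb; exists phi; split => //.
- by move=> x y xI yJ; apply: (up (s1 sV)).
- by move=> x y xI yJ; apply: (down (s2 sV)).
Qed.
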